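(* There are exactly $19$ diffeomorphism classes of $5$-dimensional real Bott manifolds of the form $M(A)=T^2\times_{(\mathbb{Z}_2)^s}M(B)$ ($s\in\{1,2\}$) with $M(B)$ a $3$-dimensional real Bott manifold, i.e. of $5$-dimensional real Bott manifolds admitting the maximal $T^2$-action.
   Context: A Bott matrix of size $n$ is an $n\times n$ upper triangular matrix $A=(a_{ij})$ with $a_{ii}=1$ for all $i$ and $a_{ij}\in\{0,1\}$ for $i<j$. Let $S^1\subset\mathbb{C}$ be the unit circle and $T^n=(S^1)^n$. A Bott matrix $A$ defines a free action of $(\mathbb{Z}_2)^n=\langle g_1,\dots,g_n\rangle$ on $T^n$ by $$g_i(z_1,\dots,z_n)=(z_1,\dots,z_{i-1},-z_i,\tilde z_{i+1},\dots,\tilde z_n),$$ where for $j>i$, $\tilde z_j=\bar z_j$ if $a_{ij}=1$ and $\tilde z_j=z_j$ if $a_{ij}=0$. The quotient smooth manifold $M(A)=T^n/(\mathbb{Z}_2)^n$ is called an ($n$-dimensional) real Bott manifold. $M(A)$ is said to admit the maximal $T^k$-action, where $k$ is the number of columns of $A$ whose only nonzero entry is the diagonal entry (equivalently, $k$ is the rank of the maximal central free abelian subgroup of $\pi_1(M(A))$; it is a diffeomorphism invariant). Moving these columns (and simultaneously the corresponding rows) to the front, which does not change the diffeomorphism class of $M(A)$, brings $A$ to the form $\begin{pmatrix} I_k & C\\ 0& B\end{pmatrix}$, where $B$ is a Bott matrix of size $n-k$ and each of the last $n-k$ columns has at least two nonzero entries. The rows of $C$ act on $M(B)$ by complex conjugation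 of the coordinates at which the row has entry $1$, generating a group of transformations isomorphic to $(\mathbb{Z}_2)^s$ with $s=\operatorname{rank}_{\mathbb{F}_2}C$; one writes $M(A)=T^k\times_{(\mathbb{Z}_2)^s}M(B)$. *)

(* Defs.v *)
From HB Require Import structures.
From mathcomp Require Import all_boot all_order all_algebra.
From mathcomp Require Import complex.
From mathcomp Require Import boolp classical_sets functions reals.
From mathcomp Require Import topology normedtype derive trigo.

Set Implicit Arguments.
Unset Strict Implicit.
Unset Printing Implicit Defensive.

Import Order.TTheory GRing.Theory Num.Theory.
Import numFieldNormedType.Exports.

Local Open Scope classical_set_scope.
Local Open Scope ring_scope.

(* ** Smooth maps between manifolds given by local parametrizations *)

Section Smooth.
Variable R : realType.

Definition iter_partial (n m : nat) (s : seq 'I_n) (F : 'rV[R]_n -> 'rV[R]_m) :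
    'rV[R]_n -> 'rV[R]_m :=
  foldr (fun i G x => 'D_(delta_mx 0 i) G x) F s.

(* C^oo on U: all iterated partial derivatives, including F itself (s = [::]),
   exist and are continuous at every point of U.  Meant for open U, where
   continuity and derivatives at x only depend on F near x. *)
Definition smooth_on (n m : nat) (U : set 'rV[R]_n)
    (F : 'rV[R]_n -> 'rV[R]_m) : Prop :=
  forall (s : seq 'I_n) (x : 'rV[R]_n), U x ->
    {for x, continuous (iter_partial s F)} /\
    (forall i : 'I_n, derivable (iter_partial s F) x (delta_mx 0 i)).

(* A manifold structure on the set M is presented, as in do Carmo's "Riemannian
   Geometry", by a family of injective local parametrizations phi : U -> M,
   with U open in R^n, i.e. inverses of charts; the topology of M is the one
   they induce.  A pair (U, phi) only matters through the restriction of phi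
   to U. *)
Definition atlas (n : nat) (M : Type) : Type :=
  set (set 'rV[R]_n * ('rV[R]_n -> M)).

(* f is smooth when, around every point p, it reads in suitable
   parametrizations phi at p and psi at f p as a smooth map
   F = psi^-1 o f o phi : U -> V. *)
Definition smooth_map (n m : nat) (M N : Type) (aM : atlas n M)
    (aN : atlas m N) (f : M -> N) : Prop :=
  forall p : M,
  exists (U : set 'rV[R]_n) (phi : 'rV[R]_n -> M)
         (V : set 'rV[R]_m) (psi : 'rV[R]_m -> N) (F : 'rV[R]_n -> 'rV[R]_m),
    [/\ aM (U, phi) /\ aN (V, psi),
        (phi @` U) p,
        (forall x, U x -> V (F x) /\ psi (F x) = f (phi x)) &
        smooth_on U F].

Definition diffeomorphism (n m : nat) (M N : Type) (aM : atlas n M)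
    (aN : atlas m N) (f : M -> N) : Prop :=
  smooth_map aM aN f /\
  exists g : N -> M, [/\ cancel f g, cancel g f & smooth_map aN aM g].

End Smooth.

(* ** The torus *)

Section Torus.
Variable R : realType.

Definition circle : Type := {z : R[i] | `|z| == 1}.

Lemma circle_opp_subproof (z : circle) : `|- val z| == 1.
Proof. by rewrite normrN (valP z). Qed.

Definition circle_opp (z : circle) : circle :=
  exist _ (- val z) (circle_opp_subproof z).

Lemma circle_conj_subproof (z : circle) : `|(val z)^*| == 1.
Proof. by rewrite norm_conjC (valP z). Qed.

Definition circle_conj (z : circle) : circle :=
  exist _ (val z)^* (circle_conj_subproof z).

Lemma circle_exp_subproof (t : R) : `|(cos t +i* sin t)%C| == 1.
Proof. by rewrite normc_def /= cos2Dsin2 sqrtr1. Qed.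

(* e^{it} *)
Definition circle_exp (t : R) : circle :=
  exist _ (cos t +i* sin t)%C (circle_exp_subproof t).

Definition torus (n : nat) : Type := {ffun 'I_n -> circle}.

Definition torus_exp (n : nat) (t : 'rV[R]_n) : torus n :=
  [ffun j => circle_exp (t 0 j)].

End Torus.

(* ** Bott matrices and real Bott manifolds *)

Definition is_bott (n : nat) (A : 'M['F_2]_n) : bool :=
  [forall i, A i i == 1] &&
  [forall i : 'I_n, forall j : 'I_n, (j < i)%N ==> (A i j == 0)].

(* The number k of columns whose only nonzero entry is the diagonal one: M(A)
   admits the maximal T^k-action. *)
Definition max_torus_rank (n : nat) (A : 'M['F_2]_n) : nat :=
  #|[pred j : 'I_n | [forall i : 'I_n, (A i j != 0) == (i == j)]]|.

(* A = (I_k C; 0 B) with B a Bott matrix, every one of the last m columns of A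
   having at least two nonzero entries, so that
   M(A) = T^k x_{(Z_2)^s} M(B) with s = \rank C. *)
Definition torus_bundle_form (k m s : nat) (A : 'M['F_2]_(k + m)) : bool :=
  [exists C : 'M['F_2]_(k, m), exists B : 'M['F_2]_m,
    [&& A == block_mx 1%:M C 0 B, is_bott B,
        [forall j : 'I_m, (2 <= #|[pred i | A i (rshift k j) != 0%R]|)%N] &
        \rank C == s]].

Section RealBott.
Variables (R : realType) (n : nat) (A : 'M['F_2]_n).

Definition bott_gen (i : 'I_n) (z : torus R n) : torus R n :=
  [ffun j => if j == i then circle_opp (z j)
             else if (i < j)%N && (A i j == 1) then circle_conj (z j)
             else z j].

(* Orbits of the group generated by the g_i; these are involutions, so words in
   the g_i suffice. *)
Definition bott_orbit (z : torus R n) : set (torus R n) :=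
  [set w | exists s : seq 'I_n, w = foldr bott_gen z s].

Definition real_bott : Type := set_type (range bott_orbit).

Definition bott_proj (z : torus R n) : real_bott :=
  exist _ (bott_orbit z) (mem_set (imageT bott_orbit z)).

(* The composite R^n -> T^n -> M(A) of the two coverings
   t |-> (e^{i t_1}, ..., e^{i t_n}) and T^n -> T^n / (Z_2)^n is a local
   diffeomorphism for the quotient smooth structure of M(A), which is therefore
   given by the restrictions of this map to the open sets where it is
   injective. *)
Definition bott_atlas : atlas R n real_bott :=
  [set c | [/\ open c.1, c.2 = bott_proj \o @torus_exp R n &
               {in c.1 &, injective c.2}]].

End RealBott.

Arguments bott_atlas R {n} A.

Definition bott_diffeomorphic (R : realType) (n m : nat)
    (A : 'M['F_2]_n) (B : 'M['F_2]_m) : Prop :=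
  exists f : real_bott R A -> real_bott R B,
    diffeomorphism (bott_atlas R A) (bott_atlas R B) f.

(* The diffeomorphism classes of the manifolds M(A), A in D, each represented
   by the set of matrices in D defining it. *)
Definition bott_diffeo_classes (R : realType) (n : nat)
    (D : {set 'M['F_2]_n}) : {set {set 'M['F_2]_n}} :=
  equivalence_partition (fun A B => `[< bott_diffeomorphic R A B >]) D.

(* Main.v *)
Require Import Defs.
From mathcomp Require Import all_boot all_order all_algebra.
From mathcomp Require Import fingroup perm.
From mathcomp Require Import ring lra zify.
From mathcomp Require Import complex.
From mathcomp Require Import boolp classical_sets reals.
From mathcomp Require Import topology normedtype derive trigo.

(* The manifold M(A) is the quotient of R^n by the group of affine maps
     x |-> ((-1)^(sum_(i < j) a_ij v_i) x_j + pi v_j)_j,  v in Z^n,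
   so a diffeomorphism M(A) -> M(B) lifts to a homeomorphism of R^n that
   conjugates the two deck groups.  An isomorphism of deck groups preserves the
   relation "the cup product of a and b vanishes" on Hom(-, F_2) = F_2^n, which
   holds iff a_i b_j + a_j b_i = a_j b_j A_ij for all i < j.  Iterating a weighted
   count of the pairs in this relation three times produces a number that takes
   19 different values on the matrices considered.  Conversely, matrices with the
   same value are connected by the three moves of Choi, Masuda and Oum, each of
   which comes from an affine isomorphism of R^n: a permutation of the
   coordinates, a quarter-turn of one circle factor, and a shear z_l := z_l z_m. *)

Set Implicit Arguments.
Unset Strict Implicit.
Unset Printing Implicit Defensive.

Import Order.TTheory GRing.Theory Num.Theory.
Import numFieldNormedType.Exports.

Local Open Scope classical_set_scope.
Local Open Scope ring_scope.

(** * The deck group and vanishing cup products *)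

(** Vanishing of a cup product is phrased as the existence of a function on the deck group whose
    coboundary is the product of two characters. Invariance under isomorphisms is then composition
    with the isomorphism, without constructing a cohomology ring, and the finite test [cup_zeroF]
    makes the relation computable. The obstacle in lifting is that smoothness gives lifts only
    locally, with no control on the size of the neighbourhoods. A compact box meeting every orbit
    provides one radius valid at all points; the lift then grows over concentric balls by steps of
    fixed length. The finite part is evaluation on boolean codes of the 1024 Bott matrices of size
    5. The moves are proved sound, and that they reach every relevant matrix from 19 representatives
    is itself confirmed by computation. *)

Lemma F2_cases (x : 'F_2) : x = 0 \/ x = 1.
Proof.
by case: x => [[|[|//]] i]; [left|right]; apply/val_inj.
Qed.

Lemma F2_addxx (x : 'F_2) : x + x = 0.
Proof. by case: (F2_cases x) => ->; apply/val_inj. Qed.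

Lemma F2_opp (x : 'F_2) : - x = x.
Proof. by apply/eqP; rewrite eq_sym -subr_eq0 opprK F2_addxx. Qed.

Lemma signF2D (S : pzRingType) (x y : 'F_2) :
  (-1) ^+ (x + y)%R = (-1) ^+ x * (-1) ^+ y :> S.
Proof.
by case: (F2_cases x) => ->; case: (F2_cases y) => -> /=;
  rewrite ?addr0 ?add0r ?F2_addxx ?mulr1 ?mul1r //= ?expr0 ?expr1 ?mulrNN ?mulr1.
Qed.

Lemma intr_signF2 (x : 'F_2) (m : int) :
  ((-1) ^+ x * m)%:~R = m%:~R :> 'F_2.
Proof.
by case: (F2_cases x) => ->; rewrite ?expr0 ?expr1 ?mul1r // mulN1r rmorphN F2_opp.
Qed.

Section DeckGroup.
Variables (n : nat) (A : 'M['F_2]_n).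
Implicit Types (u v w : 'rV[int]_n) (a b : 'rV['F_2]_n).

Definition twist v (j : 'I_n) : 'F_2 :=
  \sum_(i < n | (i < j)%N) A i j * (v 0 i)%:~R.

(** The composition law of the deck transformations, each named by its translation part divided by
    pi. *)
Definition deck_mul v w : 'rV[int]_n :=
  \row_j (v 0 j + (-1) ^+ twist v j * w 0 j).

Definition deck_inv v : 'rV[int]_n := \row_j - ((-1) ^+ twist v j * v 0 j).

Lemma twistM v w j : twist (deck_mul v w) j = twist v j + twist w j.
Proof.
rewrite /twist -big_split; apply: eq_bigr => i _.
by rewrite mxE rmorphD /= intr_signF2 mulrDr.
Qed.

Lemma twist_inv v j : twist (deck_inv v) j = twist v j.
Proof.
apply: eq_bigr => i _.
by rewrite mxE rmorphN /= intr_signF2 F2_opp.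
Qed.

Lemma twist0 j : twist 0 j = 0.
Proof. by rewrite /twist big1 // => i _; rewrite mxE mulr0. Qed.

Lemma deck_mul0 v : deck_mul v 0 = v.
Proof. by apply/rowP => j; rewrite !mxE mulr0 addr0. Qed.

Lemma deck_mulV v : deck_mul v (deck_inv v) = 0.
Proof.
by apply/rowP => j; rewrite !mxE mulrN mulrA -expr2 sqrr_sign mul1r subrr.
Qed.

Definition parity_char a v : 'F_2 := \sum_i a 0 i * (v 0 i)%:~R.

Lemma parity_charM a v w :
  parity_char a (deck_mul v w) = parity_char a v + parity_char a w.
Proof.
rewrite /parity_char -big_split; apply: eq_bigr => i _.
by rewrite mxE rmorphD /= intr_signF2 mulrDr.
Qed.

Lemma parity_charD a b v :
  parity_char (a + b) v = parity_char a v + parity_char b v.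
Proof.
by rewrite /parity_char -big_split; apply: eq_bigr => i _; rewrite mxE mulrDl.
Qed.

Lemma parity_char_delta a i : parity_char a (delta_mx 0 i) = a 0 i.
Proof.
rewrite /parity_char (bigD1 i) //= mxE !eqxx mulr1 big1 ?addr0 // => k ki.
by rewrite mxE eqxx (negbTE ki) mulr0.
Qed.

Lemma parity_char0 a : parity_char a 0 = 0.
Proof. by rewrite /parity_char big1 // => i _; rewrite mxE mulr0. Qed.

Lemma twist_delta (m : int) (k j : 'I_n) :
  (j <= k)%N -> twist (m *: delta_mx 0 k) j = 0.
Proof.
move=> jk; rewrite /twist big1 // => i ij.
rewrite !mxE eqxx /= (_ : i == k = false) ?mulr0 ?mulr0 //.
by apply/negbTE; rewrite neq_ltn (leq_trans ij jk).
Qed.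

Lemma deck_mul_delta (m p : int) k :
  deck_mul (m *: delta_mx 0 k) (p *: delta_mx 0 k) = (m + p) *: delta_mx 0 k.
Proof.
apply/rowP => j; rewrite !mxE eqxx /=; have [->|] := eqVneq j k.
  by rewrite twist_delta // mul1r !mulr1.
by rewrite !mulr0 addr0.
Qed.

Lemma deck_ind (P : 'rV[int]_n -> Prop) :
  P 0 -> (forall i, P (delta_mx 0 i)) -> (forall i, P (- delta_mx 0 i)) ->
  (forall v w, P v -> P w -> P (deck_mul v w)) -> forall v, P v.
Proof.
move=> P_0 Pe PNe PM.
have Pscale (m : int) k : P (m *: delta_mx 0 k).
  case: m => p.
    elim: p => [|p IH]; first by rewrite scale0r.
    have -> : Posz p.+1 = p%:Z + 1 by rewrite -addn1 PoszD.
    by rewrite -deck_mul_delta; apply: PM; rewrite ?scale1r.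
  rewrite NegzE; elim: p => [|p IH]; first by rewrite scaleN1r.
  have -> : - p.+2%:Z = - p.+1%:Z + -1 by rewrite -addn1 PoszD opprD.
  by rewrite -deck_mul_delta; apply: PM; rewrite ?scaleN1r.
move=> v; suff supp k : (k <= n)%N ->
    forall u, (forall j : 'I_n, (k <= j)%N -> u 0 j = 0) -> P u.
  by apply: (supp n) => // j; rewrite leqNgt ltn_ord.
elim: k => [_ u u0|k IH kn u uk].
  by have -> : u = 0 by apply/rowP => j; rewrite u0 // mxE.
pose i := Ordinal kn.
pose u' := \row_j (if (j < k)%N then u 0 j else 0).
(* The last coordinate that may be nonzero is split off on the left: a multiple of [delta_mx 0 i]
   has zero twist at all coordinates up to [i], and [u'] is supported strictly below [i]. *)
have -> : u = deck_mul (u 0 i *: delta_mx 0 i) u'.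
  apply/rowP => j; rewrite !mxE eqxx /=; case: (ltngtP j k) => jk.
  - rewrite twist_delta ?(ltnW jk) // mul1r (_ : j == i = false) ?mulr0 ?add0r //.
    by apply/negbTE; rewrite neq_ltn jk.
  - by rewrite uk // (_ : j == i = false) ?mulr0 ?addr0 // -val_eqE gtn_eqF.
  - have -> : j = i by apply/val_inj.
    by rewrite eqxx mulr0 addr0 mulr1.
apply: PM; first exact: Pscale.
by apply: (IH (ltnW kn)) => j kj; rewrite mxE ltnNge kj.
Qed.

Lemma char_parity (chi : 'rV[int]_n -> 'F_2) :
  (forall v w, chi (deck_mul v w) = chi v + chi w) ->
  forall v, chi v = parity_char (\row_i chi (delta_mx 0 i)) v.
Proof.
move=> chiM.
have chi0 : chi 0 = 0.
  have := chiM 0 0; rewrite deck_mul0 => /eqP.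
  by rewrite -subr_eq0 opprD addNKr oppr_eq0 => /eqP.
have chiN i : chi (- delta_mx 0 i) = chi (delta_mx 0 i).
  have := chiM (1 *: delta_mx 0 i) (-1 *: delta_mx 0 i).
  rewrite deck_mul_delta subrr scale0r chi0 scale1r scaleN1r => /esym/eqP.
  by rewrite addrC addr_eq0 F2_opp => /eqP.
have parityN i (a : 'rV_n) : parity_char a (- delta_mx 0 i) = a 0 i.
  rewrite -[RHS]parity_char_delta; apply: eq_bigr => k _.
  by rewrite !mxE rmorphN F2_opp.
apply: deck_ind => [|i|i|v w vE wE].
- by rewrite chi0 parity_char0.
- by rewrite parity_char_delta mxE.
- by rewrite parityN chiN mxE.
- by rewrite chiM parity_charM vE wE.
Qed.


Definition cup_zero a b : Prop := exists c : 'rV[int]_n -> 'F_2,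
  forall v w, c (deck_mul v w) = c v + c w + parity_char a v * parity_char b w.

(** In the ring generated over F_2 by x_1, ..., x_n with relations x_j^2 = x_j sum_(i < j) A_ij x_i,
    the products x_i x_j with i < j form a basis in degree 2. The test says that all coefficients of
    (sum a_i x_i)(sum b_i x_i) in this basis vanish. *)
Definition cup_zeroF a b : bool :=
  [forall i : 'I_n, forall j : 'I_n, (i < j)%N ==>
    (a 0 i * b 0 j + a 0 j * b 0 i == a 0 j * b 0 j * A i j)].

Lemma cup_zero_necessary a b : cup_zero a b -> cup_zeroF a b.
Proof.
move=> [c cM]; apply/forallP => i; apply/forallP => j; apply/implyP => ij.
pose e k : 'rV[int]_n := delta_mx 0 k; pose s : int := (-1) ^+ A i j.
have sF2 : s%:~R = 1 :> 'F_2 by rewrite -[s]mulr1 intr_signF2.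
have chi_se d : parity_char d (s *: e j) = d 0 j.
  rewrite -[RHS]parity_char_delta; apply: eq_bigr => k _.
  by rewrite !mxE rmorphM /= sF2 mul1r.
(* The condition for the pair (i, j) results from evaluating [c] on both sides of this relation
   between generators. *)
have comm : deck_mul (e i) (e j) = deck_mul (s *: e j) (e i).
  apply/rowP => l; rewrite !mxE !eqxx /=.
  have [->|li] := eqVneq l i.
    have -> : i == j = false by apply/negbTE; rewrite neq_ltn ij.
    by rewrite twist_delta ?(ltnW ij) // !mulr0 mulr1 addr0 add0r.
  have [->|lj] := eqVneq l j; last by rewrite !mulr0.
  rewrite !mulr0 !mulr1 add0r addr0; congr (_ ^+ nat_of_ord _).
  rewrite /twist (bigD1 i) //= mxE !eqxx mulr1 big1 ?addr0 // => k /andP[_ ki].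
  by rewrite mxE (negbTE ki) mulr0.
have c0 : c 0 = 0.
  have := cM 0 0; rewrite deck_mul0 parity_char0 mul0r addr0 => /eqP.
  by rewrite -subr_eq0 opprD addNKr oppr_eq0 => /eqP.
(* For s = -1 the value at the inverse of e_j is read off from the product of e_j with its
   inverse. *)
have cs : c (s *: e j) = c (e j) + a 0 j * b 0 j * A i j.
  rewrite /s; case: (F2_cases (A i j)) => ->; first by rewrite expr0 scale1r mulr0 addr0.
  have := cM (1 *: e j) (-1 *: e j).
  rewrite deck_mul_delta subrr scale0r c0 scale1r expr1.
  have -> : parity_char b (-1 *: e j) = b 0 j.
    rewrite -[RHS]parity_char_delta; apply: eq_bigr => k _.
    by rewrite !mxE mulN1r rmorphN F2_opp.
  rewrite parity_char_delta mulr1 => /eqP.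
  by rewrite eq_sym addrAC addr_eq0 F2_opp => /eqP <-.
have := cM (e i) (e j); rewrite comm cM cs chi_se !parity_char_delta => H.
have -> : a 0 i * b 0 j = a 0 j * b 0 j * A i j + a 0 j * b 0 i.
  by apply: (addrI (c (e i) + c (e j))); rewrite -H; ring.
by rewrite -addrA F2_addxx addr0.
Qed.

(* The coboundary of v |-> half_parity v_j is the cup product of x_j with
   x_j + sum_(i < j) a_ij x_i; the cochain trivializing a b below combines these
   with the symmetric products v_i v_j. *)
Definition half_parity (m : int) : 'F_2 := ((m %/ 2)%Z)%:~R.

(** The term m p is the carry when two odd numbers are added. The term x p appears because division
    rounds down: negating an odd number changes the parity of its half. *)
Lemma half_parity_sign (x : 'F_2) (m p : int) :
  half_parity (m + (-1) ^+ x * p) =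
  half_parity m + half_parity p + m%:~R * p%:~R + x * p%:~R.
Proof.
have F22 : 2%:~R = 0 :> 'F_2 by apply/val_inj.
rewrite /half_parity {1 3}(divz_eq m 2) {1 3 4}(divz_eq p 2).
have := @ltz_pmod m 2 isT; have := @modz_ge0 m 2 isT.
have := @ltz_pmod p 2 isT; have := @modz_ge0 p 2 isT.
move: (m %/ 2)%Z (m %% 2)%Z (p %/ 2)%Z (p %% 2)%Z => q r q' r' r'0 r'2 r0 r2.
have -> : ((q * 2 + r + (-1) ^+ x * (q' * 2 + r')) %/ 2)%Z =
   q + (-1) ^+ x * q' + ((r + (-1) ^+ x * r') %/ 2)%Z.
  by rewrite -divzMDl //; congr (_ %/ _)%Z; ring.
have s1 : ((-1) ^+ x)%:~R = 1 :> 'F_2 by rewrite -[X in X%:~R]mulr1 intr_signF2.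
rewrite !rmorphD /= !rmorphM /= F22 s1 !mulr0 !add0r mul1r -!addrA.
congr (_ + (_ + _)).
have [->|->] : r = 0 \/ r = 1 by lia.
  all: have [->|->] : r' = 0 \/ r' = 1 by lia.
  all: by case: (F2_cases x) => ->; apply/val_inj.
Qed.

Lemma cup_zero_sufficient a b : cup_zeroF a b -> cup_zero a b.
Proof.
move=> /forallP ab.
exists (fun v => \sum_(j < n) (a 0 j * b 0 j * half_parity (v 0 j) +
   \sum_(i < n | (i < j)%N) a 0 j * b 0 i * ((v 0 i)%:~R * (v 0 j)%:~R))) => v w.
pose X i j : 'F_2 := a 0 i * b 0 j * ((v 0 i)%:~R * (w 0 j)%:~R).
have -> : parity_char a v * parity_char b w =
    \sum_(j < n) (X j j + \sum_(i < n | (i < j)%N) (X i j + X j i)).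
  have -> : parity_char a v * parity_char b w = \sum_(j < n) \sum_i X i j.
    rewrite /parity_char mulrC mulr_suml; apply: eq_bigr => j _.
    by rewrite mulr_sumr; apply: eq_bigr => i _; rewrite /X; ring.
  transitivity (\sum_(j < n) X j j + \sum_(j < n) \sum_(i < n | (i < j)%N) X i j +
                \sum_(j < n) \sum_(i < n | (i < j)%N) X j i).
    rewrite [X in _ = _ + X](exchange_big_dep predT) //= -!big_split /=.
    apply: eq_bigr => j _; rewrite (bigD1 j) //= -addrA; congr (_ + _).
    rewrite (bigID (fun i : 'I_n => (i < j)%N)) /=; congr (_ + _); apply: eq_bigl => i.
      by rewrite neq_ltn; case: ltngtP.
    by rewrite neq_ltn; case: ltngtP.
  by rewrite -!big_split /=; apply: eq_bigr => j _; rewrite big_split addrA.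
rewrite -!big_split /=; apply: eq_bigr => j _.
rewrite mxE half_parity_sign.
have -> : a 0 j * b 0 j * (half_parity (v 0 j) + half_parity (w 0 j) +
     (v 0 j)%:~R * (w 0 j)%:~R + twist v j * (w 0 j)%:~R) =
   a 0 j * b 0 j * half_parity (v 0 j) + a 0 j * b 0 j * half_parity (w 0 j) +
   X j j + \sum_(i < n | (i < j)%N) a 0 j * b 0 j * A i j * ((v 0 i)%:~R * (w 0 j)%:~R).
  rewrite 3!mulrDr; congr (_ + _); rewrite mulrA mulr_sumr mulr_suml.
  by apply: eq_bigr => i _; ring.
suff -> : \sum_(i < n | (i < j)%N) a 0 j * b 0 i *
     ((deck_mul v w 0 i)%:~R * (v 0 j + (-1) ^+ twist v j * w 0 j)%:~R) =
   \sum_(i < n | (i < j)%N) a 0 j * b 0 i * ((v 0 i)%:~R * (v 0 j)%:~R) +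
   \sum_(i < n | (i < j)%N) a 0 j * b 0 i * ((w 0 i)%:~R * (w 0 j)%:~R) +
   (\sum_(i < n | (i < j)%N) a 0 j * b 0 j * A i j * ((v 0 i)%:~R * (w 0 j)%:~R) +
    \sum_(i < n | (i < j)%N) (X i j + X j i)).
  (* [ring] does not know that x + x = 0 in F_2, so the sum occurring twice on the left is also
     added twice on the right. *)
  set S := \sum_(i < n | _) a 0 j * b 0 j * A i j * _.
  by rewrite -[RHS]addr0 -(F2_addxx S); ring.
rewrite -!big_split /=; apply: eq_bigr => i ij.
rewrite mxE !rmorphD /= !intr_signF2.
(* The assumption enters here: it replaces the coefficient a_j b_j A_ij of v_i w_j, which comes from
   the reflections, by a_i b_j + a_j b_i. *)
have /forallP/(_ j)/implyP/(_ ij)/eqP <- := ab i; rewrite /X.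
set t := a 0 i * b 0 j * ((v 0 i)%:~R * (w 0 j)%:~R).
by rewrite -[LHS]addr0 -(F2_addxx t) /t; ring.
Qed.

Lemma cup_zeroP a b : cup_zero a b <-> cup_zeroF a b.
Proof. by split; [exact: cup_zero_necessary | exact: cup_zero_sufficient]. Qed.

End DeckGroup.

(** * A numerical invariant of the deck group *)

Section Invariant.
Variable n : nat.
Implicit Types A B : 'M['F_2]_n.

(* The shape of the weights, the modulus 7 and the final polynomial w (w + 3) were
   found by search, so as to separate the 19 classes. *)
Definition cup_step A (W : 'rV['F_2]_n -> nat) (a : 'rV['F_2]_n) : nat :=
  (\sum_b (W b + cup_zeroF A a b) * W (a + b)%R)%N %% 7.

Definition cup_weight A (k : nat) : 'rV['F_2]_n -> nat :=
  iter k (cup_step A) (fun=> 1%N).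

Definition cup_invariant A : nat := (\sum_a cup_weight A 3 a * (cup_weight A 3 a + 3))%N.

Definition deck_morphism A B (phi : 'rV[int]_n -> 'rV[int]_n) :=
  forall v w, phi (deck_mul A v w) = deck_mul B (phi v) (phi w).

Definition char_pullback (phi : 'rV[int]_n -> 'rV[int]_n) (a : 'rV['F_2]_n) :
  'rV['F_2]_n := \row_i parity_char a (phi (delta_mx 0 i)).

Lemma char_pullbackE A B phi a v : deck_morphism A B phi ->
  parity_char (char_pullback phi a) v = parity_char a (phi v).
Proof.
move=> phiM; rewrite (@char_parity _ A (fun u => parity_char a (phi u))) //.
by move=> u w; rewrite phiM parity_charM.
Qed.

Lemma cup_zero_pullback A B phi a b : deck_morphism A B phi ->
  cup_zero B a b -> cup_zero A (char_pullback phi a) (char_pullback phi b).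
Proof.
move=> phiM [c cM]; exists (c \o phi) => v w /=.
by rewrite phiM cM !(char_pullbackE _ _ phiM).
Qed.

Lemma char_pullbackK A B phi psi : deck_morphism A B phi ->
  cancel psi phi -> cancel (char_pullback phi) (char_pullback psi).
Proof.
move=> phiM psiK a; apply/rowP => i.
by rewrite mxE (char_pullbackE _ _ phiM) psiK parity_char_delta.
Qed.

(** The invariant is built only from addition of characters and the relation [cup_zero], and the
    additive bijection [char_pullback phi] respects both. The two directions of [gF] use [psi] and
    [phi] respectively. *)
Lemma cup_invariant_iso A B phi psi :
  deck_morphism A B phi -> deck_morphism B A psi ->
  cancel phi psi -> cancel psi phi -> cup_invariant A = cup_invariant B.
Proof.
move=> phiM psiM phiK psiK.
pose g := char_pullback phi; pose h := char_pullback psi.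
have gK : cancel g h by exact: char_pullbackK phiM psiK.
have hK : cancel h g by exact: char_pullbackK psiM phiK.
have g_bij : bijective g by exists h.
have gD a b : g (a + b) = g a + g b.
  by apply/rowP => i; rewrite !mxE parity_charD.
have gF a b : cup_zeroF A (g a) (g b) = cup_zeroF B a b.
  apply/idP/idP => /cup_zeroP ab; apply/cup_zeroP; last exact: cup_zero_pullback ab.
  by rewrite -(gK a) -(gK b); apply: cup_zero_pullback ab.
have weightE k a : cup_weight A k (g a) = cup_weight B k a.
  elim: k a => // k IH a; rewrite /cup_weight !iterS -!/(cup_weight _ k) /cup_step.
  congr (_ %% _)%N; rewrite (reindex g) /=; last exact: onW_bij.
  by apply: eq_bigr => b _; rewrite -gD !IH gF.
rewrite /cup_invariant (reindex g); last exact: onW_bij.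
by apply: eq_bigr => a _; rewrite weightE.
Qed.

End Invariant.

(** * The universal covering of a real Bott manifold *)

Section CircleExp.
Variable R : realType.
Implicit Types s t : R.

Lemma circle_expP s t :
  circle_exp s = circle_exp t <-> cos s = cos t /\ sin s = sin t.
Proof.
split=> [[/= [-> ->]] //|[st1 st2]]; apply/val_inj => /=.
by rewrite st1 st2.
Qed.

Lemma circle_expDpi s : circle_exp (s + pi) = circle_opp (circle_exp s).
Proof.
apply/val_inj/eqP; rewrite eq_complex /=.
by rewrite cosDpi sinDpi !eqxx.
Qed.

Lemma circle_expN s : circle_exp (- s) = circle_conj (circle_exp s).
Proof.
by apply/val_inj/eqP; rewrite eq_complex /= cosN sinN !eqxx.
Qed.

Lemma circle_exp_int s (m : int) :
  circle_exp (s + 2 * m%:~R * pi) = circle_exp s.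
Proof.
have step t : circle_exp (t + pi *+ 2) = circle_exp t.
  by apply/circle_expP; rewrite cosD2pi sinD2pi.
have nat_case t (p : nat) : circle_exp (t + 2 * p%:R * pi) = circle_exp t.
  elim: p => [|p IH]; first by rewrite mulr0 mul0r addr0.
  rewrite -[RHS]IH -[RHS]step; congr circle_exp.
  by rewrite -natr1 -mulr_natl; ring.
case: m => p; first exact: nat_case.
rewrite -[LHS](nat_case _ p.+1) NegzE; congr circle_exp.
by rewrite rmorphN /=; ring.
Qed.

Lemma circle_exp_inj s t :
  circle_exp s = circle_exp t -> exists m : int, t = s + 2 * m%:~R * pi.
Proof.
move=> /circle_expP [cE sE].
pose m := Num.floor ((t - s) / (2 * pi)).
have pi0 := @pi_gt0 R.
have twopi_gt0 : 0 < 2 * pi :> R by rewrite mulr_gt0.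
pose r := t - s - 2 * m%:~R * pi.
have r0 : 0 <= r.
  have := floor_le ((t - s) / (2 * pi)); rewrite -/m ler_pdivlMr // => h.
  by rewrite /r; lra.
have r1 : r < 2 * pi.
  have := floorD1_gt ((t - s) / (2 * pi)); rewrite -/m ltr_pdivrMr // rmorphD /= => h.
  by rewrite /r; lra.
have cr : cos r = 1.
  have /circle_expP[h _] : circle_exp r = circle_exp (t - s).
    by rewrite -(circle_exp_int r m); congr circle_exp; rewrite /r; ring.
  by rewrite h cosB cE sE -!expr2 cos2Dsin2.
exists m; suff : r = 0 by rewrite /r => h; lra.
(* [cos] is injective on [0, pi] only, so a remainder beyond pi is replaced by 2 pi - r. *)
have [rpi|pir] := leP r pi.
  by apply: cos_inj; rewrite ?in_itv /= ?r0 ?rpi ?lexx ?(ltW pi0) // cr cos0.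
suff : 2 * pi - r = 0 by move=> h; lra.
apply: cos_inj; rewrite ?in_itv /= ?lexx ?(ltW pi0) //; first by apply/andP; split; lra.
have -> : 2 * pi - r = - r + pi *+ 2 by rewrite -mulr_natl; ring.
by rewrite cosD2pi cosN cr cos0.
Qed.

Lemma circle_exp_surj (z : circle R) : exists t, circle_exp t = z.
Proof.
case: z => -[a b] ab1.
have {}ab : a ^+ 2 + b ^+ 2 = 1.
  move: (ab1); rewrite normc_def /= => /eqP[/(congr1 (fun x => x ^+ 2))].
  by rewrite sqr_sqrtr ?expr1n // addr_ge0 // sqr_ge0.
have a1 : -1 <= a <= 1.
  rewrite -ler_norml -(ler_pXn2r (n := 2)) ?nnegrE // expr1n real_normK ?num_real //.
  by have := sqr_ge0 b; lra.
have sa : sin (acos a) = `|b|.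
  by rewrite sin_acos // -ab addrAC subrr add0r sqrtr_sqr.
have ca : cos (acos a) = a by rewrite acosK // in_itv.
have [b0|b0] := leP 0 b.
  exists (acos a); apply/val_inj/eqP; rewrite eq_complex /=.
  by rewrite ca sa ger0_norm // !eqxx.
exists (- acos a); apply/val_inj/eqP; rewrite eq_complex /=.
by rewrite cosN sinN ca sa ltr0_norm // opprK !eqxx.
Qed.

End CircleExp.

(** * The deck action on R^n and its orbits *)

Section DeckAction.
Variables (R : realType) (n : nat) (A : 'M['F_2]_n).
Implicit Types (u v w : 'rV[int]_n) (x y : 'rV[R]_n).

Definition deck_act v x : 'rV[R]_n :=
  \row_j ((-1) ^+ twist A v j * x 0 j + (v 0 j)%:~R * pi).

Lemma deck_actM v w x : deck_act v (deck_act w x) = deck_act (deck_mul A v w) x.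
Proof.
apply/rowP => j; rewrite !mxE twistM signF2D rmorphD rmorphM /= rmorph_sign.
by rewrite mulrDr mulrDl !mulrA -addrA [X in _ + X]addrC.
Qed.

Lemma deck_act0 x : deck_act 0 x = x.
Proof.
by apply/rowP => j; rewrite !mxE twist0 expr0 mul1r mul0r addr0.
Qed.

Lemma deck_actK v : cancel (deck_act v) (deck_act (deck_inv A v)).
Proof.
move=> x; rewrite deck_actM -[RHS]deck_act0; congr deck_act.
by apply/rowP => j; rewrite !mxE twist_inv addNr.
Qed.

Lemma deck_actVK v : cancel (deck_act (deck_inv A v)) (deck_act v).
Proof. by move=> x; rewrite deck_actM deck_mulV deck_act0. Qed.

Lemma deck_act_at0 v : deck_act v 0 = \row_j ((v 0 j)%:~R * pi).
Proof. by apply/rowP => j; rewrite !mxE mulr0 add0r. Qed.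

(* At the first nonzero coordinate of v the twist is trivial, so that there the
   displacement is a nonzero multiple of pi. *)
Lemma deck_act_discrete v x :
  (forall j, `|deck_act v x 0 j - x 0 j| < pi) -> v = 0.
Proof.
move=> close; apply/rowP => j; rewrite [RHS]mxE.
suff H k : forall i : 'I_n, (i < k)%N -> v 0 i = 0 by exact: (H j.+1).
elim: k => // k IH i; rewrite ltnS => ik.
have twist_i : twist A v i = 0.
  rewrite /twist big1 // => l li.
  by rewrite IH ?mulr0 // (leq_trans li).
have := close i; rewrite mxE twist_i expr0 mul1r addrAC subrr add0r.
rewrite normrM (ger0_norm (@pi_ge0 R)) -ltr_pdivlMr ?pi_gt0 //.
rewrite divff ?gt_eqF ?pi_gt0 // -intr_norm -[1]/(1%:~R) ltr_int.
by move=> h; lia.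
Qed.

(** The action is free: w^-1 v fixes x and hence is trivial by discreteness. Evaluation at the
    origin then recovers v and w from their translation parts. *)
Lemma deck_act_inj v w x : deck_act v x = deck_act w x -> v = w.
Proof.
move=> vw; have : deck_mul A (deck_inv A w) v = 0.
  apply: (@deck_act_discrete _ x) => j.
  by rewrite -deck_actM vw deck_actK subrr normr0 pi_gt0.
move=> h; have : deck_act v 0 = deck_act w 0.
  by rewrite -{1}(deck_actVK w (deck_act v 0)) (deck_actM (deck_inv A w)) h deck_act0.
rewrite !deck_act_at0 => /rowP e; apply/rowP => j.
have := e j; rewrite !mxE => /(mulIf _) /= e'.
by apply/eqP; rewrite -(eqr_int R); apply/eqP/e'; rewrite gt_eqF ?pi_gt0.
Qed.

Lemma deck_act_dist v x y j :
  `|deck_act v x 0 j - deck_act v y 0 j| = `|x 0 j - y 0 j|.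
Proof.
have -> : deck_act v x 0 j - deck_act v y 0 j = (-1) ^+ twist A v j * (x 0 j - y 0 j).
  by rewrite !mxE opprD addrACA subrr addr0 mulrBr.
by rewrite normrM normrX normrN1 expr1n mul1r.
Qed.

(** Even vectors therefore act by translations in 2 pi Z^n, the deck group of the covering of T^n by
    R^n. *)
Lemma twist_even u j : twist A (u *+ 2) j = 0.
Proof. by rewrite /twist big1 // => i _; rewrite mulr2n mxE rmorphD F2_addxx mulr0. Qed.

Lemma deck_act_even u x :
  deck_act (u *+ 2) x = \row_j (x 0 j + 2 * (u 0 j)%:~R * pi).
Proof.
apply/rowP => j; rewrite !mxE twist_even.
by rewrite mul1r mulr2n rmorphD /=; ring.
Qed.

Lemma torus_exp_eq x y : torus_exp x = torus_exp y <->
  exists u, y = deck_act (u *+ 2) x.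
Proof.
split=> [/ffunP xy|[u ->]]; last first.
  by rewrite deck_act_even; apply/ffunP => j; rewrite !ffunE mxE circle_exp_int.
have ex j : exists m : int, y 0 j = x 0 j + 2 * m%:~R * pi.
  by apply: circle_exp_inj; have := xy j; rewrite !ffunE.
have [u uE] := choice ex; exists (\row_j u j).
by rewrite deck_act_even; apply/rowP => j; rewrite !mxE uE.
Qed.

Lemma torus_exp_surj (z : torus R n) : exists x, torus_exp x = z.
Proof.
have [x xE] := choice (fun j => circle_exp_surj (z j)).
by exists (\row_j x j); apply/ffunP => j; rewrite ffunE mxE xE.
Qed.

Lemma bott_gen_exp i x :
  bott_gen A i (torus_exp x) = torus_exp (deck_act (delta_mx 0 i) x).
Proof.
apply/ffunP => j; rewrite !ffunE mxE; have [->|ji] := eqVneq j i.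
  rewrite mxE !eqxx mul1r -circle_expDpi; congr (circle_exp (_ + _)).
  by rewrite -[delta_mx _ _]scale1r twist_delta // mul1r.
have tE : twist A (delta_mx 0 i) j = if (i < j)%N then A i j else 0.
  rewrite /twist; case: ifP => [ij|ij].
    rewrite (bigD1 i) //= mxE !eqxx mulr1 big1 ?addr0 // => k /andP[_ ki].
    by rewrite mxE (negbTE ki) mulr0.
  rewrite big1 // => k kj; rewrite mxE (_ : k == i = false) ?mulr0 //.
  by apply: contraFF ij => /eqP <-.
rewrite tE mxE (negbTE ji) mul0r addr0; case: ltnP => _ /=; last by rewrite expr0 mul1r.
by case: (F2_cases (A i j)) => ->; rewrite ?expr0 ?expr1 ?mul1r // mulN1r circle_expN.
Qed.

Lemma word_deck (s : seq 'I_n) :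
  exists v, forall x, foldr (bott_gen A) (torus_exp x) s = torus_exp (deck_act v x).
Proof.
elim: s => [|i s [v IH]]; first by exists 0 => x; rewrite deck_act0.
by exists (deck_mul A (delta_mx 0 i) v) => x; rewrite /= IH bott_gen_exp deck_actM.
Qed.

Lemma deck_word v :
  exists s, forall x, torus_exp (deck_act v x) = foldr (bott_gen A) (torus_exp x) s.
Proof.
move: v; apply: (deck_ind (A := A)) => [|i|i|v w [s sE] [t tE]].
- by exists [::] => x; rewrite deck_act0.
- by exists [:: i] => x; rewrite /= bott_gen_exp.
(* On the torus g_i is an involution: [delta_mx 0 i] and its negative differ by a translation of the
   lattice 2 pi Z^n, so the same word serves for both. *)
- exists [:: i] => x; rewrite /= bott_gen_exp; apply/torus_exp_eq.
  exists (delta_mx 0 i); rewrite deck_actM; congr deck_act; apply/rowP => j.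
  by rewrite [RHS]mxE twist_even mul1r mulr2n !mxE addrK.
- by exists (s ++ t) => x; rewrite -deck_actM foldr_cat -tE sE.
Qed.

Definition bott_cover x : real_bott R A := bott_proj A (torus_exp x).

Lemma bott_cover_eq x y : bott_cover x = bott_cover y <-> exists v, y = deck_act v x.
Proof.
split=> [|[v ->]].
  move=> /(congr1 val) /= xy; have : bott_orbit A (torus_exp y) (torus_exp y) by exists [::].
  rewrite -xy => -[s]; have [v ->] := word_deck s.
  move=> /esym /torus_exp_eq[u ->].
  by exists (deck_mul A (u *+ 2) v); rewrite deck_actM.
have sub w z : bott_orbit A (torus_exp (deck_act w z)) `<=` bott_orbit A (torus_exp z).
  move=> t [s ->]; have [s' ->] := deck_word w.
  by exists (s ++ s'); rewrite foldr_cat.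
apply: val_inj => /=; apply/seteqP; split=> //.
by rewrite -{1}(deck_actK v x); apply: sub.
Qed.

Lemma bott_cover_surj (p : real_bott R A) : exists x, bott_cover x = p.
Proof.
case: p => o op; have [z _ zo] := set_mem op.
by have [x xz] := torus_exp_surj z; exists x; apply: val_inj; rewrite /= xz.
Qed.

End DeckAction.

(** * Affine diffeomorphisms *)

Section RowTopology.
Variable R : realType.

Lemma row_ballE (n : nat) (x y : 'rV[R]_n) (e : R) : 0 < e ->
  ball x e y <-> forall j, `|x 0 j - y 0 j| < e.
Proof.
move=> e0; split=> [[_ xy] j|xy]; first exact: xy.
by split=> // i j; rewrite ord1; exact: xy.
Qed.

Lemma row_continuous (T : topologicalType) (n : nat) (f : T -> 'rV[R]_n) (x : T) :
  (forall j, {for x, continuous (fun y => f y 0 j : R)}) -> {for x, continuous f}.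
Proof.
move=> fx; apply/cvg_ballP => e e0.
have : \forall y \near x, forall j, ball (f x 0 j) e (f y 0 j).
  by apply: filter_forall => j; have /cvg_ballP/(_ e e0) := fx j.
by apply: filterS => y fxy; split=> // i j; rewrite ord1; exact: fxy.
Qed.

Definition affine_map (n m : nat) (M : 'M[R]_(n, m)) (c : 'rV[R]_m)
  (x : 'rV[R]_n) : 'rV[R]_m := x *m M + c.

Lemma affine_continuous (n m : nat) (M : 'M[R]_(n, m)) (c : 'rV[R]_m) :
  continuous (affine_map M c).
Proof.
move=> x; apply: row_continuous => j.
rewrite (_ : (fun y : 'rV_n => _) = fun y : 'rV_n => \sum_i y 0 i * M i j + c 0 j); last first.
  by apply/funext => y; rewrite !mxE.
apply: continuousD; last exact: cst_continuous.
apply: (@continuous_big _ _ _ 0 predT) => [|i _ y]; first exact: add_continuous.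
by apply: continuousM; [exact: coord_continuous | exact: cst_continuous].
Qed.

Lemma affine_is_derive (n m : nat) (M : 'M[R]_(n, m)) (c : 'rV[R]_m) x v :
  is_derive x v (affine_map M c) (v *m M).
Proof.
have quot : h^-1 *: (affine_map M c (h *: v + x) - affine_map M c x) @[h --> 0^'] --> v *m M.
  apply: cvg_near_cst; near=> h.
  have h0 : h != 0 by near: h; exact: nbhs_dnbhs_neq.
  rewrite /affine_map opprD addrACA subrr addr0 mulmxDl addrK -scalemxAl.
  by rewrite scalerA mulVf // scale1r.
split; first by apply/cvg_ex; exists (v *m M).
by apply: cvg_lim quot; exact: norm_hausdorff.
Unshelve. all: by end_near.
Qed.

(** Affine maps are closed under partial derivatives, which are constant; the induction over
    iterated derivatives stays among affine maps. *)
Lemma affine_smooth (n m : nat) (M : 'M[R]_(n, m)) (c : 'rV[R]_m) U :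
  smooth_on U (affine_map M c).
Proof.
have aff s : exists N d, iter_partial s (affine_map M c) = affine_map N d.
  elim: s => [|i s [N [d /= E]]]; first by exists M, c.
  exists 0, (delta_mx 0 i *m N); rewrite /= -/(iter_partial _ _) E; apply/funext => x.
  have [_ ->] := affine_is_derive N d x (delta_mx 0 i).
  by rewrite /affine_map mulmx0 add0r.
move=> s x _; have [N [d ->]] := aff s; split; first exact: affine_continuous.
by move=> i; have [] := affine_is_derive N d x (delta_mx 0 i).
Qed.

End RowTopology.

(** * Affine maps that descend to diffeomorphisms *)

Section AffineEquiv.
Variables (R : realType) (n : nat).
Implicit Types A B C : 'M['F_2]_n.

(** Compatibility is expressed through the fibres of the coverings rather than an isomorphism of
    deck groups, which makes composition and inversion immediate. *)
Definition affine_equiv A B : Prop := exists (M M' : 'M[R]_n) (c : 'rV[R]_n),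
  [/\ M *m M' = 1%:M, M' *m M = 1%:M & forall x y,
      bott_cover A x = bott_cover A y <->
      bott_cover B (affine_map M c x) = bott_cover B (affine_map M c y)].

Lemma affine_equiv_refl A : affine_equiv A A.
Proof.
exists 1%:M, 1%:M, 0; split; rewrite ?mulmx1 // => x y.
by rewrite /affine_map !mulmx1 !addr0.
Qed.

Lemma affine_mapK (M M' : 'M[R]_n) c : M *m M' = 1%:M ->
  cancel (affine_map M c) (affine_map M' (- (c *m M'))).
Proof.
by move=> MM x; rewrite /affine_map mulmxDl -mulmxA MM mulmx1 addrK.
Qed.

Lemma affine_mapVK (M M' : 'M[R]_n) c : M' *m M = 1%:M ->
  cancel (affine_map M' (- (c *m M'))) (affine_map M c).
Proof.
by move=> MM x; rewrite /affine_map mulmxDl mulNmx -!mulmxA MM !mulmx1 subrK.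
Qed.

Lemma affine_equiv_sym A B : affine_equiv A B -> affine_equiv B A.
Proof.
move=> [M [M' [c [MM' M'M E]]]]; exists M', M, (- (c *m M')); split=> // x y.
by rewrite E !affine_mapVK.
Qed.

Lemma affine_equiv_trans A B C :
  affine_equiv A B -> affine_equiv B C -> affine_equiv A C.
Proof.
move=> [M [M' [c [MM' M'M E]]]] [N [N' [d [NN' N'N F]]]].
exists (M *m N), (N' *m M'), (c *m N + d); split.
- by rewrite mulmxA -(mulmxA M) NN' mulmx1.
- by rewrite mulmxA -(mulmxA N') M'M mulmx1.
move=> x y; have comp z : affine_map (M *m N) (c *m N + d) z =
    affine_map N d (affine_map M c z).
  by rewrite /affine_map mulmxDl mulmxA addrA.
by rewrite !comp E F.
Qed.

(** Two points of a ball of radius pi/2 differ by less than pi in each coordinate, the bound in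
    [deck_act_discrete]. *)
Lemma bott_cover_ball_inj A (x0 x y : 'rV[R]_n) :
  ball x0 (pi / 2) x -> ball x0 (pi / 2) y -> bott_cover A x = bott_cover A y -> x = y.
Proof.
have pi2 : 0 < pi / 2 :> R by rewrite divr_gt0 ?pi_gt0.
move=> /(row_ballE _ _ pi2) x0x /(row_ballE _ _ pi2) x0y /bott_cover_eq [v yE].
suff v0 : v = 0 by rewrite yE v0 deck_act0.
apply: (@deck_act_discrete R _ A _ x) => j; rewrite -yE.
have := x0x j; have := x0y j; rewrite distrC => h1 h2.
rewrite (_ : y 0 j - x 0 j = y 0 j - x0 0 j + (x0 0 j - x 0 j)); last by ring.
by apply: le_lt_trans (ler_normD _ _) _; rewrite [ltRHS]splitr ltrD.
Qed.

Lemma affine_descends_smooth A B (M M' : 'M[R]_n) c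
    (f : real_bott R A -> real_bott R B) :
  M *m M' = 1%:M -> M' *m M = 1%:M -> injective f ->
  (forall x, f (bott_cover A x) = bott_cover B (affine_map M c x)) ->
  smooth_map (bott_atlas R A) (bott_atlas R B) f.
Proof.
move=> MM' M'M f_inj fE p.
have [x0 <-] := bott_cover_surj p.
have pi2 : 0 < pi / 2 :> R by rewrite divr_gt0 ?pi_gt0.
pose L' := affine_map M' (- (c *m M')).
(* The target chart is the affine image of the source ball, so that [f] reads as the affine map
   itself. The covering is injective on that image because [f] is injective. *)
exists (ball x0 (pi / 2)), (@bott_cover R n A),
  (L' @^-1` ball x0 (pi / 2)), (@bott_cover R n B), (affine_map M c); split.
- split; split=> //=; first exact: ball_open.
  - by move=> x y /set_mem x0x /set_mem x0y; exact: bott_cover_ball_inj x0x x0y.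
  - by apply: open_comp => [x _|]; [exact: affine_continuous | exact: ball_open].
  - move=> x y /set_mem x0x /set_mem x0y.
    rewrite -(affine_mapVK c M'M x) -(affine_mapVK c M'M y) => /= xy.
    congr affine_map; apply: bott_cover_ball_inj x0x x0y _.
    by apply: f_inj; rewrite !fE.
- by exists x0 => //; exact: ballxx.
- by move=> x x0x; split; rewrite ?fE //= /L' affine_mapK.
- exact: affine_smooth.
Qed.

Lemma affine_equiv_diffeomorphic A B : affine_equiv A B -> bott_diffeomorphic R A B.
Proof.
move=> [M [M' [c [MM' M'M E]]]].
pose rA p := sval (cid (@bott_cover_surj R n A p)).
have rAK p : bott_cover A (rA p) = p by rewrite /rA; case: cid.
pose rB p := sval (cid (@bott_cover_surj R n B p)).
have rBK p : bott_cover B (rB p) = p by rewrite /rB; case: cid.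
pose L := affine_map M c; pose L' := affine_map M' (- (c *m M')).
pose f p := bott_cover B (L (rA p)); pose g p := bott_cover A (L' (rB p)).
have fE x : f (bott_cover A x) = bott_cover B (L x) by apply/E; rewrite rAK.
have gE x : g (bott_cover B x) = bott_cover A (L' x).
  by apply/E; rewrite !affine_mapVK // rBK.
have fK : cancel f g.
  by move=> p; rewrite -(rAK p) fE gE /L' /L affine_mapK.
have gK : cancel g f.
  by move=> p; rewrite -(rBK p) gE fE /L' /L affine_mapVK.
exists f; split; first exact: affine_descends_smooth MM' M'M (can_inj fK) fE.
exists g; split=> //; exact: affine_descends_smooth M'M MM' (can_inj gK) gE.
Qed.

End AffineEquiv.

(** * Lifting through coverings of a normed space *)

Lemma star_shaped_connected (R : realType) (V : normedModType R) (U : set V) (x : V) :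
  U x -> (forall y, U y -> forall t : R, 0 <= t <= 1 -> U (x + t *: (y - x))) ->
  connected U.
Proof.
move=> Ux star.
pose seg y : set V := (fun t : R => x + t *: (y - x)) @` `[0, 1]%classic.
have -> : U = \bigcup_(y in U) seg y.
  apply/seteqP; split=> [y Uy|z [y Uy [t]]].
    exists y => //; exists 1; first by rewrite /= in_itv /= ler01 lexx.
    by rewrite scale1r addrC subrK.
  by rewrite /= in_itv /= => t01 <-; exact: star.
apply: bigcup_connected.
  exists x => y Uy; exists 0; first by rewrite /= in_itv /= ler01 lexx.
  by rewrite scale0r addr0.
move=> y _; apply: connected_continuous_connected; first exact: segment_connected.
apply: continuous_subspaceT => t.
have : (x + s *: (y - x)) @[s --> t] --> x + t *: (y - x).
  by apply: cvgD; [exact: cvg_cst | exact: scalel_continuous].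
exact.
Qed.

Section Lifting.
Variables (R : realType) (X Y : normedModType R) (T : Type).
Variables (q : Y -> T) (h : X -> T) (d : R).
Hypothesis d_gt0 : 0 < d.
(** A metric form of a regular covering: fibres are uniformly separated by [d], and continuous maps
    over [q] act transitively on each fibre. *)
Hypothesis q_discrete : forall y z, q y = q z -> ball y d z -> y = z.
Hypothesis q_transitive : forall y z, q y = q z ->
  exists g : Y -> Y, [/\ continuous g, forall w, q (g w) = q w & g y = z].

Definition lift_on (U : set X) (F : X -> Y) :=
  forall x, U x -> {for x, continuous F} /\ q (F x) = h x.

Lemma lift_onS U V F : V `<=` U -> lift_on U F -> lift_on V F.
Proof. by move=> VU liftF x /VU; exact: liftF. Qed.

(** Near any point both lifts move by less than d/2. Hence agreement persists nearby by separation
    of fibres, and so does disagreement; the coincidence set is open and closed in the connected set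
    [U]. *)
Lemma lift_unique U F G x y : open U -> connected U ->
  lift_on U F -> lift_on U G -> U x -> F x = G x -> U y -> F y = G y.
Proof.
move=> oU cU liftF liftG Ux FGx Uy.
pose E := [set z | U z /\ F z = G z]; pose N := [set z | U z /\ F z <> G z].
have d20 : 0 < d / 2 by rewrite divr_gt0.
have close z : U z -> \forall w \near z,
    [/\ U w, ball (F z) (d / 2) (F w) & ball (G z) (d / 2) (G w)].
  move=> Uz; have [Fz _] := liftF z Uz; have [Gz _] := liftG z Uz.
  have nU : \forall w \near z, U w by apply: open_nbhs_nbhs.
  have nF : \forall w \near z, ball (F z) (d / 2) (F w) by apply: Fz; exact: nbhsx_ballx.
  have nG : \forall w \near z, ball (G z) (d / 2) (G w) by apply: Gz; exact: nbhsx_ballx.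
  by near=> w; split; near: w.
have qFG z : U z -> q (F z) = q (G z).
  by move=> Uz; rewrite (liftF z Uz).2 (liftG z Uz).2.
have oE : open E.
  rewrite openE => z [Uz FGz]; rewrite /interior; apply: filterS (close z Uz) => w [Uw Fw Gw].
  split=> //; apply: q_discrete; first exact: qFG.
  by rewrite (splitr d); apply: ball_triangle (ball_sym Fw) _; rewrite FGz.
have oN : open N.
  rewrite openE => z [Uz FGz]; rewrite /interior; apply: filterS (close z Uz) => w [Uw Fw Gw].
  split=> // FGw; apply: FGz; apply: q_discrete; first exact: qFG.
  by rewrite (splitr d); apply: ball_triangle Fw _; rewrite FGw; exact: ball_sym.
suff EU : E = U by move: Uy; rewrite -EU => -[].
apply: cU; first by exists x.
  by exists E => //; apply/seteqP; split=> [z [Uz FGz]|z []].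
exists (~` N); first by rewrite closedC.
apply/seteqP; split=> [z [Uz FGz]|z [Uz Nz]]; first by split=> // -[].
by split=> //; apply: contrapT => FGz; apply: Nz.
Unshelve. all: by end_near.
Qed.

Lemma ball_star (a x y : X) (r t : R) : 0 <= t <= 1 ->
  ball a r x -> ball a r y -> ball a r (x + t *: (y - x)).
Proof.
move=> /andP[t0 t1]; rewrite -!ball_normE /ball_ /= => ax ay.
have -> : a - (x + t *: (y - x)) = (1 - t) *: (a - x) + t *: (a - y).
  rewrite (_ : y - x = (a - x) - (a - y)); last by rewrite opprB [RHS]addrC addrA subrK.
  by rewrite opprD addrA [in RHS]scalerBl scale1r scalerBr opprB addrA [RHS]addrAC.
have [->|tn1] := eqVneq t 1.
  by rewrite subrr scale0r add0r scale1r.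
apply: le_lt_trans (ler_normD _ _) _; rewrite !normrZ.
have t1' : 0 < 1 - t by rewrite subr_gt0 lt_neqAle tn1.
rewrite (ger0_norm t0) (gtr0_norm t1').
rewrite (_ : r = (1 - t) * r + t * r); last by ring.
by apply: ltr_leD; [rewrite ltr_pM2l | rewrite ler_wpM2l // ltW].
Qed.

Section GlobalLift.
Variables (x0 : X) (y0 : Y) (e : R).
Hypothesis e_gt0 : 0 < e.
Hypothesis local_lift : forall x, exists H, lift_on (ball x e) H.
Hypothesis base : q y0 = h x0.

Lemma local_lift_at x y : q y = h x -> exists H, lift_on (ball x e) H /\ H x = y.
Proof.
move=> yx; have [H liftH] := local_lift x.
have [|g [gc gq gH]] := @q_transitive (H x) y.
  by rewrite yx (liftH x (ballxx x e_gt0)).2.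
exists (g \o H); split=> // z xz; have [Hz qHz] := liftH z xz.
by split; [apply: continuous_comp => //; exact: gc | rewrite /= gq].
Qed.

Lemma lift_extend r F : 0 < r -> lift_on (ball x0 r) F ->
  exists F', lift_on (ball x0 (r + e / 2)) F' /\
    forall x, ball x0 r x -> F' x = F x.
Proof.
move=> r0 liftF; have e20 : 0 < e / 2 by rewrite divr_gt0.
have re0 : 0 < r + e / 2 by rewrite addr_gt0.
have exH x : exists H, ball x0 r x -> lift_on (ball x e) H /\ H x = F x.
  have [x0x|//] := pselect (ball x0 r x); last by exists F.
  by have [H] := local_lift_at (liftF x x0x).2; exists H.
have [H HP] := choice exH.
have HF x z : ball x0 r x -> ball x0 r z -> ball x e z -> H x z = F z.
  move=> x0x x0z xz; have [liftH Hx] := HP x x0x.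
  have xx := ballxx x e_gt0.
  apply: (@lift_unique (ball x e `&` ball x0 r) _ _ x) => //.
  - by apply: openI; exact: ball_open.
  - apply: (@star_shaped_connected _ _ _ x) => // y [xy x0y] t t01.
    by split; apply: ball_star.
  - by apply: lift_onS liftH => ? [].
  - by apply: lift_onS liftF => ? [].
have HH x x' y : ball x0 r x -> ball x0 r x' -> ball x e y -> ball x' e y ->
    H x y = H x' y.
  move=> x0x x0x' xy x'y; have [liftH _] := HP x x0x; have [liftH' _] := HP x' x0x'.
  (* The two local lifts are compared at the midpoint of their centres. By convexity it lies in the
     smaller ball, where both equal [F], and the intersection of the two balls is star-shaped about
     it. *)
  pose z := x + 2^-1 *: (x' - x).
  have half01 : 0 <= (2^-1 : R) <= 1 by apply/andP; split; lra.
  have x0z : ball x0 r z by apply: ball_star.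
  have xx' : `|x - x'| < e + e.
    by have := ball_triangle xy (ball_sym x'y); rewrite -ball_normE.
  have xz : ball x e z.
    rewrite -ball_normE /ball_ /= /z opprD addrA subrr add0r normrN normrZ distrC.
    by rewrite ger0_norm; [lra|lra].
  have x'z : ball x' e z.
    have -> : z = x' + 2^-1 *: (x - x').
      rewrite /z -[x - x']opprB scalerN; set u := x' - x.
      have -> : x' = x + u by rewrite addrC subrK.
      rewrite -addrA -{2}[u]scale1r -scalerBl; congr (_ + _ *: _); lra.
    rewrite -ball_normE /ball_ /= opprD addrA subrr add0r normrN normrZ.
    by rewrite ger0_norm; [lra|lra].
  apply: (@lift_unique (ball x e `&` ball x' e) _ _ z) => //.
  - by apply: openI; exact: ball_open.
  - apply: (@star_shaped_connected _ _ _ z) => // w [xw x'w] t t01.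
    by split; apply: ball_star.
  - by apply: lift_onS liftH => ? [].
  - by apply: lift_onS liftH' => ? [].
  - by rewrite !HF.
(* A point y of the larger ball lies within e of the point p y of the smaller
   one, and the extension uses the local lift around p y. *)
pose c := r / (r + e / 2); pose p y := x0 + c *: (y - x0).
have c0 : 0 < c by rewrite divr_gt0.
have pr y : ball x0 (r + e / 2) y -> ball x0 r (p y).
  rewrite -!ball_normE /ball_ /= => x0y.
  rewrite /p opprD addrA subrr add0r normrN normrZ gtr0_norm //.
  by rewrite /c mulrAC ltr_pdivrMr // ltr_pM2l // distrC.
have pe y : ball x0 (r + e / 2) y -> ball (p y) e y.
  rewrite -!ball_normE /ball_ /= => x0y.
  have -> : p y - y = (1 - c) *: (x0 - y).
    rewrite /p scalerBl scale1r -[y - x0]opprB scalerN addrAC.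
    by [].
  rewrite normrZ; have -> : 1 - c = (e / 2) / (r + e / 2).
    by rewrite /c -[X in X - _](@divff _ (r + e / 2)) ?gt_eqF // -mulrBl addrAC subrr add0r.
  rewrite gtr0_norm ?divr_gt0 // mulrAC -mulrA.
  apply: (@lt_trans _ _ (e / 2)); last lra.
  by rewrite -[ltRHS]mulr1 ltr_pM2l // ltr_pdivrMr // mul1r.
have sub : ball x0 r `<=` ball x0 (r + e / 2).
  by apply: le_ball; rewrite lerDl ltW.
exists (fun y => H (p y) y); split=> [y x0y|y x0y]; last first.
  by apply: HF => //; [apply: pr|apply: pe]; exact: sub.
have [liftH _] := HP _ (pr y x0y); have [cH qH] := liftH y (pe y x0y).
split=> //.
have near_eq : \forall z \near y, H (p y) z = H (p z) z.
  have n1 : \forall z \near y, ball x0 (r + e / 2) z.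
    by apply: open_nbhs_nbhs; split=> //; exact: ball_open.
  have n2 : \forall z \near y, ball (p y) e z.
    by apply: open_nbhs_nbhs; split; [exact: ball_open | exact: pe].
  near=> z; apply: HH; first exact: pr.
  - by apply: pr; near: z.
  - by near: z.
  - by apply: pe; near: z.
exact: cvg_trans (near_eq_cvg near_eq) cH.
Unshelve. all: by end_near.
Qed.

Lemma global_lift : exists F, lift_on setT F /\ F x0 = y0.
Proof.
have e20 : 0 < e / 2 by rewrite divr_gt0.
have [F0 [liftF0 F0x0]] := local_lift_at base.
pose r k := e + k%:R * (e / 2).
have r_gt0 k : 0 < r k by rewrite ltr_pwDl // mulr_ge0 // ltW.
have rS k : r k.+1 = r k + e / 2 by rewrite /r -natr1 mulrDl mul1r addrA.
(* The extension is stated conditionally so that choice yields a total function [ext], which can be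
   iterated before its iterates are known to be lifts. *)
have exE (kF : nat * (X -> Y)) : exists F', lift_on (ball x0 (r kF.1)) kF.2 ->
    lift_on (ball x0 (r kF.1.+1)) F' /\ forall x, ball x0 (r kF.1) x -> F' x = kF.2 x.
  have [liftF|//] := pselect (lift_on (ball x0 (r kF.1)) kF.2); last by exists kF.2.
  by have [F'] := lift_extend (r_gt0 kF.1) liftF; rewrite -rS; exists F'.
have [ext extP] := choice exE.
pose F := fix F k := if k is k'.+1 then ext (k', F k') else F0.
have liftF k : lift_on (ball x0 (r k)) (F k).
  elim: k => [|k IH]; first by rewrite /r mul0r addr0.
  by have [] := extP (k, F k) IH.
have FS k x : ball x0 (r k) x -> F k.+1 x = F k x.
  by have [_] := extP (k, F k) (liftF k); exact.
have r_mono k l : (k <= l)%N -> ball x0 (r k) `<=` ball x0 (r l).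
  by move=> kl; apply: le_ball; rewrite lerD2l ler_wpM2r ?ler_nat // ltW.
have F_mono k l x : (k <= l)%N -> ball x0 (r k) x -> F l x = F k x.
  move=> /subnK <-; elim: (l - k)%N => // i IH kx.
  by rewrite addSn FS ?IH //; apply: (r_mono k) => //; exact: leq_addl.
have Feq k l x : ball x0 (r k) x -> ball x0 (r l) x -> F l x = F k x.
  move=> kx lx; have [kl|lk] := leqP k l; first exact: F_mono.
  by rewrite (@F_mono l k) // ltnW.
have cover x : exists k, ball x0 (r k) x.
  have [k kE] : exists k : nat, `|x0 - x| / (e / 2) < k%:R.
    by exists (Num.truncn (`|x0 - x| / (e / 2))).+1; exact: truncnS_gt.
  exists k; rewrite -ball_normE /ball_ /=.
  by move: kE; rewrite ltr_pdivrMr // /r => kE; rewrite ltr_wpDl // ltW.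
have [N NP] := choice cover.
exists (fun x => F (N x) x); split; last first.
  by rewrite (@Feq 0%N) //; apply: ballxx.
move=> x _; have [cF qF] := liftF (N x) x (NP x); split=> //.
have near_eq : \forall z \near x, F (N x) z = F (N z) z.
  have n1 : \forall z \near x, ball x0 (r (N x)) z.
    by apply: open_nbhs_nbhs; split; [exact: ball_open | exact: NP].
  by near=> z; apply: Feq => //; near: z.
exact: cvg_trans (near_eq_cvg near_eq) cF.
Unshelve. all: by end_near.
Qed.

End GlobalLift.

End Lifting.

(** * Diffeomorphisms induce isomorphisms of deck groups *)

Section DeckIsomorphism.
Variables (R : realType) (n : nat).
Implicit Types A B : 'M['F_2]_n.

Lemma deck_act_continuous A v : continuous (@deck_act R n A v).
Proof.
have -> : deck_act A v = affine_map (diag_mx (\row_j (-1) ^+ twist A v j))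
    (\row_j ((v 0 j)%:~R * pi)) :> ('rV[R]_n -> 'rV[R]_n).
  apply/funext => x; apply/rowP => j; rewrite /affine_map mul_mx_diag !mxE.
  by rewrite [in RHS]mulrC.
exact: affine_continuous.
Qed.

Lemma bott_cover_act A v (x : 'rV[R]_n) : bott_cover A (deck_act A v x) = bott_cover A x.
Proof. by apply/esym/bott_cover_eq; exists v. Qed.

Lemma bott_cover_discrete A (y z : 'rV[R]_n) :
  bott_cover A y = bott_cover A z -> ball y pi z -> y = z.
Proof.
move=> /bott_cover_eq[v ->] /(row_ballE _ _ (@pi_gt0 R)) yz.
suff -> : v = 0 by rewrite deck_act0.
by apply: (@deck_act_discrete R _ A _ y) => j; rewrite distrC.
Qed.

Lemma bott_cover_transitive A (y z : 'rV[R]_n) : bott_cover A y = bott_cover A z ->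
  exists g : 'rV[R]_n -> 'rV[R]_n,
    [/\ continuous g, forall w, bott_cover A (g w) = bott_cover A w & g y = z].
Proof.
move=> /bott_cover_eq[v ->]; exists (deck_act A v); split=> //.
- exact: deck_act_continuous.
- by move=> w; exact: bott_cover_act.
Qed.

Section Lift.
Variables (A B : 'M['F_2]_n) (f : real_bott R A -> real_bott R B).

Notation lift_f := (lift_on (@bott_cover R n B) (f \o @bott_cover R n A)).

Lemma smooth_local_lift (x : 'rV[R]_n) :
  smooth_map (bott_atlas R A) (bott_atlas R B) f ->
  exists2 e, 0 < e & exists H, lift_f (ball x e) H.
Proof.
move=> /(_ (bott_cover A x)) [U [phi [V [psi [F]]]]].
move=> [[[/= oU phiE _] [/= _ psiE _]] [x0 Ux0 x0x] FE Fsmooth].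
(* The chart supplied by smoothness contains some point [x0] over the same point of the manifold,
   possibly not [x] itself; a deck transformation moves [x] there. *)
have [v vE] : exists v, x0 = deck_act A v x.
  by apply/bott_cover_eq; rewrite -x0x phiE.
have : \forall y \near x, U (deck_act A v y).
  apply: deck_act_continuous; rewrite -vE.
  exact: open_nbhs_nbhs.
move=> /nbhs_ballP[e e0 eU]; exists e => //; exists (F \o deck_act A v) => y xy.
have Uy := eU _ xy; split.
  apply: continuous_comp; first exact: deck_act_continuous.
  by have [] := Fsmooth [::] _ Uy.
have [_] := FE _ Uy; rewrite psiE phiE => qF.
transitivity (f (bott_cover A (deck_act A v y))).
  exact: qF.
by rewrite bott_cover_act.
Qed.

(** Compactness gives one radius for all centres in the box [0, 2 pi]^n. Every other centre is
    brought into the box by a translation of 2 pi Z^n, which preserves balls and the covering. *)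
Lemma smooth_uniform_lift :
  smooth_map (bott_atlas R A) (bott_atlas R B) f ->
  exists2 e, 0 < e & forall x, exists H, lift_f (ball x e) H.
Proof.
move=> fsmooth.
pose K := [set x : 'rV[R]_n | forall j, `[0, 2 * pi]%classic (x ord0 j)].
have /compact_near_coveringP coverK : compact K.
  by apply: (@rV_compact _ _ (fun=> `[0, 2 * pi]%classic)) => _; exact: segment_compact.
pose P (e : R) (x : 'rV[R]_n) := exists H, lift_f (ball x e) H.
have /filter_ex[e [e0 eP]] : \forall e \near (0 : R)^'+, 0 < e /\ K `<=` P e.
  apply: filterI; first exact: nbhs_right_gt.
  apply: (coverK R (0 : R)^'+ P) => x _; have [e e0 [H liftH]] := smooth_local_lift x fsmooth.
  have e20 : 0 < e / 2 by rewrite divr_gt0.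
  exists (ball x (e / 2), [set e' | e' < e / 2]).
    by split; [exact: nbhsx_ballx | exact: nbhs_right_lt].
  move=> [y e'] /= [xy e'e]; exists H; apply: lift_onS liftH => z yz.
  rewrite (splitr e); apply: ball_triangle xy _.
  by apply: le_ball yz; exact: ltW.
exists e => // x.
pose u : 'rV[int]_n := \row_j - Num.floor (x 0 j / (2 * pi)).
pose y := deck_act A (u *+ 2) x.
have Ky : K y.
  move=> j; rewrite /y deck_act_even !mxE rmorphN /= in_itv /=.
  have twopi_gt0 : 0 < 2 * pi :> R by rewrite mulr_gt0 ?pi_gt0.
  have := floor_le (x 0 j / (2 * pi)); rewrite ler_pdivlMr // => h1.
  have := floorD1_gt (x 0 j / (2 * pi)); rewrite ltr_pdivrMr // rmorphD /= => h2.
  by apply/andP; split; lra.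
have [H liftH] := eP y Ky; exists (H \o deck_act A (u *+ 2)) => z xz.
have yz : ball y e (deck_act A (u *+ 2) z).
  by apply/row_ballE => // j; rewrite deck_act_dist; move: j; apply/row_ballE.
have [Hz qHz] := liftH _ yz; split; last by rewrite /= qHz /= bott_cover_act.
by apply: continuous_comp => //; exact: deck_act_continuous.
Qed.

(** For each v, [F] after v and a suitable w after [F] are lifts of the same map that agree at 0,
    hence everywhere. Freeness of the action makes the assignment of w to v multiplicative. *)
Lemma lift_morphism (F : 'rV[R]_n -> 'rV[R]_n) : lift_f setT F ->
  exists2 phi, deck_morphism A B phi &
    forall v x, F (deck_act A v x) = deck_act B (phi v) (F x).
Proof.
move=> liftF.
have exphi v : exists w, forall x, F (deck_act A v x) = deck_act B w (F x).
  have [w wE] : exists w, F (deck_act A v 0) = deck_act B w (F 0).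
    apply/bott_cover_eq.
    by rewrite (liftF 0 I).2 (liftF (deck_act A v 0) I).2 /= bott_cover_act.
  exists w => x.
  apply: (@lift_unique _ _ _ _ (@bott_cover R n B) (f \o @bott_cover R n A) pi _ _ setT
    (F \o deck_act A v) (deck_act B w \o F) 0 x).
  - exact: pi_gt0.
  - by move=> y z; exact: bott_cover_discrete.
  - exact: openT.
  - exact: (star_shaped_connected (x := 0)).
  - move=> y _; have [_ qF] := liftF (deck_act A v y) I; split.
      apply: continuous_comp; first exact: deck_act_continuous.
      by have [] := liftF (deck_act A v y) I.
    by rewrite /= qF /= bott_cover_act.
  - move=> y _; have [cF qF] := liftF y I; split.
      by apply: continuous_comp => //; exact: deck_act_continuous.
    by rewrite /= bott_cover_act qF.
  - exact: I.
  - exact: wE.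
  - exact: I.
have [phi phiE] := choice exphi; exists phi => [v w|]; last exact: phiE.
apply: (@deck_act_inj R _ B _ _ (F 0)).
by rewrite -phiE -!deck_actM -!phiE.
Qed.

End Lift.

Lemma lift_cancel A B (f : real_bott R A -> real_bott R B)
    (g : real_bott R B -> real_bott R A) F G x0 :
  cancel f g ->
  lift_on (@bott_cover R n B) (f \o @bott_cover R n A) setT F ->
  lift_on (@bott_cover R n A) (g \o @bott_cover R n B) setT G ->
  G (F x0) = x0 -> cancel F G.
Proof.
move=> fK liftF liftG GF0 x.
apply: (@lift_unique _ _ _ _ (@bott_cover R n A) (@bott_cover R n A) pi _ _ setT
    (G \o F) id x0 x).
- exact: pi_gt0.
- by move=> y z; exact: bott_cover_discrete.
- exact: openT.
- exact: (star_shaped_connected (x := x0)).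
- move=> y _; have [cF qF] := liftF y I; have [cG qG] := liftG (F y) I; split.
    exact: continuous_comp.
  by rewrite /= qG /= qF /= fK.
- by move=> y _; split; [exact: cvg_id|].
- exact: I.
- exact: GF0.
- exact: I.
Qed.

Lemma diffeomorphic_cup_invariant A B :
  bott_diffeomorphic R A B -> cup_invariant A = cup_invariant B.
Proof.
move=> [f [fsmooth [g [fK gK gsmooth]]]].
have [e e0 eP] := smooth_uniform_lift fsmooth.
have [e' e'0 e'P] := smooth_uniform_lift gsmooth.
have [y0 y0E] := bott_cover_surj (f (bott_cover A 0)).
have [F [liftF F0]] := global_lift (@pi_gt0 R) (@bott_cover_discrete B)
  (@bott_cover_transitive B) e0 eP y0E.
have gy0 : bott_cover A 0 = (g \o @bott_cover R n B) y0 by rewrite /= y0E fK.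
(* The base points are matched, F 0 = y0 and G y0 = 0, so that both composites fix a point and are
   the identity by uniqueness of lifts. *)
have [G [liftG G0]] := global_lift (@pi_gt0 R) (@bott_cover_discrete A)
  (@bott_cover_transitive A) e'0 e'P gy0.
have FK : cancel F G by apply: (lift_cancel (x0 := 0) fK liftF liftG); rewrite F0.
have GK : cancel G F by apply: (lift_cancel (x0 := y0) gK liftG liftF); rewrite G0.
have [phi phiM phiE] := lift_morphism liftF.
have [psi psiM psiE] := lift_morphism liftG.
apply: (cup_invariant_iso phiM psiM) => v.
  by apply: (@deck_act_inj R _ A _ _ (G (F 0))); rewrite -psiE -phiE !FK.
by apply: (@deck_act_inj R _ B _ _ (F (G 0))); rewrite -phiE -psiE !GK.
Qed.

End DeckIsomorphism.

(** * The three moves *)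

Section Moves.
Variables (R : realType) (n : nat).
Implicit Types A B : 'M['F_2]_n.

Lemma affine_equiv_deck A B (M M' : 'M[R]_n) (c : 'rV[R]_n) :
  M *m M' = 1%:M -> M' *m M = 1%:M ->
  (forall v x, exists w, affine_map M c (deck_act A v x) = deck_act B w (affine_map M c x)) ->
  (forall v x, exists w, affine_map M' (- (c *m M')) (deck_act B v x) =
                         deck_act A w (affine_map M' (- (c *m M')) x)) ->
  affine_equiv R A B.
Proof.
move=> MM' M'M AB BA; exists M, M', c; split=> // x y.
split=> /bott_cover_eq[v].
  by move=> ->; have [w ->] := AB v x; apply/bott_cover_eq; exists w.
move=> /(congr1 (affine_map M' (- (c *m M')))); rewrite affine_mapK //.
by have [w ->] := BA v (affine_map M c x); rewrite affine_mapK // => ->;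
  apply/bott_cover_eq; exists w.
Qed.

Definition upper_triangular A := forall i j : 'I_n, (j < i)%N -> A i j = 0.

(** A permutation of the coordinates destroys the condition i < j but preserves i != j. *)
Lemma twist_upper A v j : upper_triangular A ->
  twist A v j = \sum_(i < n | i != j) A i j * (v 0 i)%:~R.
Proof.
move=> upA; rewrite [RHS](bigID (fun i : 'I_n => (i < j)%N)) /= [X in _ = _ + X]big1.
  rewrite addr0; apply: eq_bigl => i.
  by rewrite -val_eqE neq_ltn; case: ltngtP.
by move=> i; rewrite -val_eqE -leqNgt => /andP[ij ji];
  rewrite upA ?mul0r // ltn_neqAle eq_sym ij.
Qed.

Definition relabel_mx (s : {perm 'I_n}) A : 'M['F_2]_n := \matrix_(i, j) A (s i) (s j).

Lemma relabel_deck A (s : {perm 'I_n}) v (x : 'rV[R]_n) :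
  upper_triangular A -> upper_triangular (relabel_mx s A) ->
  col_perm s (deck_act A v x) = deck_act (relabel_mx s A) (col_perm s v) (col_perm s x).
Proof.
move=> upA upB; apply/rowP => j; rewrite !mxE; congr ((-1) ^+ nat_of_ord _ * _ + _).
rewrite !twist_upper // (reindex_inj (@perm_inj _ s)) /=.
by apply: eq_big => [i|i _]; rewrite ?(inj_eq perm_inj) // !mxE.
Qed.

Lemma relabel_equiv A (s : {perm 'I_n}) :
  upper_triangular A -> upper_triangular (relabel_mx s A) ->
  affine_equiv R A (relabel_mx s A).
Proof.
move=> upA upB.
have L t : affine_map (perm_mx t^-1) 0 = col_perm t :> ('rV[R]_n -> 'rV[R]_n).
  by apply/funext => x; rewrite /affine_map addr0 col_permE.
have K : relabel_mx s^-1 (relabel_mx s A) = A.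
  by apply/matrixP => i j; rewrite !mxE !permKV.
apply: (@affine_equiv_deck _ _ (perm_mx s^-1) (perm_mx s) 0).
- by rewrite -perm_mxM mulVg perm_mx1.
- by rewrite -perm_mxM mulgV perm_mx1.
- by move=> v x; exists (col_perm s v); rewrite L relabel_deck.
- move=> v x; exists (col_perm s^-1 v); rewrite mul0mx oppr0.
  by rewrite -[perm_mx s]/(perm_mx _) -[in perm_mx s](invgK s) L relabel_deck ?K.
Qed.

(** The quarter-turn of z_k makes g_i acquire a factor g_k whenever it conjugates z_k, so row [k] is
    added to those rows beyond the column [k]. *)
Definition shift_mx (k : 'I_n) A : 'M['F_2]_n :=
  \matrix_(i, j) (A i j + if (i < k < j)%N then A i k * A k j else 0).

Lemma shift_mxK k : involutive (shift_mx k).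
Proof.
move=> A; apply/matrixP => i j; rewrite !mxE !ltnn !andbF !addr0.
by case: ifP => _; rewrite ?addr0 // -addrA F2_addxx addr0.
Qed.

Lemma F2_sum_lt (F : 'I_n -> 'F_2) (k j : 'I_n) :
  \sum_(i < n | (i < j)%N) (if (i < k < j)%N then F i else 0) =
  if (k < j)%N then \sum_(i < n | (i < k)%N) F i else 0.
Proof.
rewrite -big_mkcondr; case: ifP => kj; last first.
  by apply: big_pred0 => i /=; rewrite !andbF.
apply: eq_bigl => i; rewrite andbT; apply/andb_idl => ik.
exact: ltn_trans kj.
Qed.

(* Conjugating by the translation x_k + pi/2 turns a reflection in x_k into the
   same reflection followed by a half-turn of x_k. *)
Lemma shift_deck A (k : 'I_n) (b : bool) v (x : 'rV[R]_n) :
  exists w, deck_act A v x + ((-1) ^+ b * (pi / 2)) *: delta_mx 0 k =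
    deck_act (shift_mx k A) w (x + ((-1) ^+ b * (pi / 2)) *: delta_mx 0 k).
Proof.
(* If v reflects x_k, the translation by t pi/2, with t the sign given by [b], comes out as -t pi/2;
   raising v_k by t makes up for the difference. The two values of [b] give the move and its
   inverse. *)
pose w : 'rV[int]_n :=
  \row_j (v 0 j + if j == k then (-1) ^+ b * (twist A v k : nat)%:Z else 0).
have wF2 j : (w 0 j)%:~R = (v 0 j)%:~R + (if j == k then twist A v k else 0) :> 'F_2.
  rewrite mxE rmorphD /=; case: ifP => // _; congr (_ + _).
  rewrite rmorphM rmorph_sign F2_opp expr1n mul1r.
  by case: (F2_cases (twist A v k)) => ->.
have twist_w j : twist (shift_mx k A) w j = twist A v j.
  rewrite /twist; transitivity (\sum_(i < n | (i < j)%N) (A i j * (v 0 i)%:~R +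
      (if i == k then A k j * twist A v k else 0) +
      (if (i < k < j)%N then A i k * (v 0 i)%:~R else 0) * A k j)).
    apply: eq_bigr => i _; rewrite mxE wF2; have [->|ik] := eqVneq i k.
      by rewrite ltnn !addr0 mul0r addr0 mulrDr.
    by rewrite !addr0 mulrDl; case: ifP => _; rewrite ?mul0r // mulrAC.
  rewrite !big_split /= -mulr_suml F2_sum_lt -big_mkcondr /=.
  case: ifP => kj; last first.
    rewrite mul0r addr0 [X in _ + X]big_pred0 ?addr0 // => i.
    by apply/negbTE/negP => /andP[ij /eqP ik]; rewrite ik kj in ij.
  rewrite [X in _ + X + _](big_pred1 k); last first.
    by move=> i /=; apply/andb_idl => /eqP ->.
  by rewrite -/(twist A v k) [_ * A k j]mulrC -addrA F2_addxx addr0.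
exists w; apply/rowP => j; rewrite [RHS]mxE twist_w !mxE eqxx /=.
have [->|jk] := eqVneq j k; last by rewrite !mulr0 !addr0.
rewrite mulr1 rmorphD rmorphM rmorph_sign /=.
move: ((-1) ^+ b) => t {w wF2 twist_w}.
by case: (F2_cases (twist A v k)) => ->; rewrite ?expr0 ?expr1 ?mulr0z ?mulr1z; field.
Qed.

Lemma shift_equiv A k : affine_equiv R A (shift_mx k A).
Proof.
apply: (@affine_equiv_deck _ _ 1%:M 1%:M ((pi / 2) *: delta_mx 0 k)); rewrite ?mulmx1 //.
  move=> v x; have [w wE] := shift_deck A k false v x; exists w.
  by move: wE; rewrite /affine_map !mulmx1 expr0 mul1r.
move=> v x; have [w wE] := shift_deck (shift_mx k A) k true v x; exists w.
by move: wE; rewrite shift_mxK /affine_map !mulmx1 expr1 mulN1r scaleNr.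
Qed.

(** In the new coordinate z_l z_m the half-turn of z_m by g_m also turns coordinate l, so g_m
    acquires a factor g_l and row [l] is added to row [m]. *)
Definition shear_mx (m l : 'I_n) A : 'M['F_2]_n :=
  \matrix_(i, j) (A i j + if (i == m) && (l < j)%N then A l j else 0).

(** Every g_i conjugates z_l exactly when it conjugates z_m, so that, up to sign, z_l z_m is fixed
    or conjugated. *)
Definition same_column (m l : 'I_n) A : Prop :=
  (m < l)%N /\ forall i : 'I_n, (i < l)%N -> A i l = if (i < m)%N then A i m else 0.

Lemma shear_mxK (m l : 'I_n) A : (m < l)%N -> shear_mx m l (shear_mx m l A) = A.
Proof.
move=> ml; apply/matrixP => i j.
have lm : (l == m) = false by rewrite -val_eqE gtn_eqF.
rewrite !mxE lm /= addr0.
by case: ifP => _; rewrite ?addr0 // -addrA F2_addxx addr0.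
Qed.

Lemma shear_same_column m l A : same_column m l A -> same_column m l (shear_mx m l A).
Proof.
move=> [ml col]; split=> // i il; rewrite !mxE ltnn andbF addr0 col //.
by rewrite [(l < m)%N]ltnNge (ltnW ml) andbF addr0.
Qed.

Lemma shear_deck A (m l : 'I_n) (b : bool) v (x : 'rV[R]_n) : same_column m l A ->
  exists w, deck_act A v x *m (1%:M + (-1) ^+ b *: delta_mx m l) =
    deck_act (shear_mx m l A) w (x *m (1%:M + (-1) ^+ b *: delta_mx m l)).
Proof.
move=> [ml col].
have LE (y : 'rV[R]_n) j : (y *m (1%:M + (-1) ^+ b *: delta_mx m l)) 0 j =
    y 0 j + if j == l then (-1) ^+ b * y 0 m else 0.
  rewrite mulmxDr mulmx1 mxE -scalemxAr mxE; congr (_ + _).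
  rewrite mxE (bigD1 m) //= mxE eqxx /= big1 => [|i im]; last by rewrite mxE (negbTE im) mulr0.
  by case: (j == l); rewrite ?mulr1 ?mulr0 addr0 ?mulr0.
have lm : l == m = false by rewrite -val_eqE gtn_eqF.
have twist_l : twist A v l = twist A v m.
  rewrite /twist; transitivity
    (\sum_(i < n | (i < l)%N) (if (i < m)%N then A i m * (v 0 i)%:~R else 0)).
    by apply: eq_bigr => i il; rewrite col //; case: ifP; rewrite ?mul0r.
  rewrite -big_mkcondr; apply: eq_bigl => i; apply/andb_idl => im; exact: ltn_trans ml.
pose w : 'rV[int]_n := \row_j (v 0 j + if j == l then (-1) ^+ b * v 0 m else 0).
have wF2 j : (w 0 j)%:~R = (v 0 j)%:~R + (if j == l then (v 0 m)%:~R else 0) :> 'F_2.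
  rewrite mxE rmorphD /=; case: ifP => // _; congr (_ + _).
  by rewrite rmorphM rmorph_sign F2_opp expr1n mul1r.
have twist_w j : twist (shear_mx m l A) w j = twist A v j.
  rewrite /twist; transitivity (\sum_(i < n | (i < j)%N) (A i j * (v 0 i)%:~R +
      (if i == l then A l j * (v 0 m)%:~R else 0) +
      (if i == m then (if (l < j)%N then A l j else 0) * (v 0 m)%:~R else 0))).
    apply: eq_bigr => i _; rewrite mxE wF2; have [->|il] := eqVneq i l.
      by rewrite lm /= !addr0 mulrDr.
    have [->|im] := eqVneq i m; last by rewrite /= !addr0.
    by rewrite /= !addr0 mulrDl.
  rewrite !big_split /= -!big_mkcondr /=; case: (ltnP l j) => lj.
    rewrite [X in _ + X + _](big_pred1 l) => [|i /=]; last by apply/andb_idl => /eqP ->.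
    rewrite [X in _ + X](big_pred1 m) => [|i /=]; last first.
      by apply/andb_idl => /eqP ->; exact: ltn_trans lj.
    by rewrite -addrA F2_addxx addr0.
  rewrite [X in _ + X + _]big_pred0 => [|i]; last first.
    by apply/negbTE/negP => /andP[ij /eqP il]; rewrite il ltnNge lj in ij.
  by rewrite addr0 [X in _ + X]big1 ?addr0 // => i _; rewrite mul0r.
exists w; apply/rowP => j; rewrite LE [RHS]mxE twist_w LE !mxE.
have [->|jl] := eqVneq j l; last by rewrite !addr0.
rewrite twist_l rmorphD rmorphM rmorph_sign /=.
by move: ((-1) ^+ twist A v m) ((-1) ^+ b) => s t; ring.
Qed.

Lemma shear_equiv A m l : same_column m l A -> affine_equiv R A (shear_mx m l A).
Proof.
move=> col; have ml := col.1.
have square0 : delta_mx m l *m delta_mx m l = 0 :> 'M[R]_n.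
  by rewrite mul_delta_mx_0 // -val_eqE gtn_eqF.
apply: (@affine_equiv_deck _ _ (1%:M + (-1) ^+ false *: delta_mx m l)
  (1%:M + (-1) ^+ true *: delta_mx m l) 0).
- rewrite expr0 scale1r expr1 scaleN1r mulmxDl mul1mx mulmxDr mulmx1 mulmxN square0.
  by rewrite oppr0 addr0 addrNK.
- rewrite expr0 scale1r expr1 scaleN1r mulmxDl mul1mx mulmxDr mulmx1 mulNmx square0.
  by rewrite oppr0 addr0 addrK.
- move=> v x; have [w wE] := shear_deck false v x col; exists w.
  by rewrite /affine_map !addr0.
- move=> v x; have [w wE] := shear_deck true v x (shear_same_column col); exists w.
  by rewrite mul0mx oppr0 /affine_map !addr0 wE shear_mxK.
Qed.

End Moves.

(** * Computation on encoded matrices *)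

Fixpoint bits (k : nat) : seq bitseq :=
  if k is k'.+1 then [seq false :: s | s <- bits k'] ++ [seq true :: s | s <- bits k']
  else [:: [::]].

Lemma mem_bits k (s : bitseq) : (s \in bits k) = (size s == k).
Proof.
elim: k s => [|k IH] [|b s] //=.
  by rewrite mem_cat; apply/orP => -[] /mapP[].
rewrite mem_cat eqSS -IH; apply/orP/idP => [[] /mapP[t tk [_ ->]] //|sk].
by case: b; [right|left]; apply/mapP; exists s.
Qed.

Lemma uniq_bits k : uniq (bits k).
Proof.
elim: k => //= k IH; rewrite cat_uniq !map_inj_uniq ?IH ?andbT /=; try by move=> ? ? [].
by apply/hasPn => _ /mapP[s _ ->]; apply/mapP => -[].
Qed.

Lemma all_iota (n : nat) (P : pred nat) : all P (iota 0 n) = [forall i : 'I_n, P i].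
Proof.
apply/allP/forallP => [allP i|allP i]; first by apply: allP; rewrite mem_iota /= ltn_ord.
by rewrite mem_iota /= => lt_in; have := allP (Ordinal lt_in).
Qed.

(* A Bott matrix of size 5 is encoded by its entries above the diagonal, read
   row by row. *)
Definition upper_pairs : seq (nat * nat) :=
  [:: (0, 1); (0, 2); (0, 3); (0, 4); (1, 2); (1, 3); (1, 4); (2, 3); (2, 4); (3, 4)]%N.

Definition entry (c : bitseq) (i j : nat) : bool :=
  (i == j) || ((i < j)%N && nth false c (index (i, j) upper_pairs)).

Definition encode (f : nat -> nat -> bool) : bitseq := [seq f p.1 p.2 | p <- upper_pairs].

Definition mx_of_code (c : bitseq) : 'M['F_2]_5 := \matrix_(i, j) (entry c i j)%:R.

Lemma mem_upper_pairs (i j : nat) : (i < j < 5)%N -> (i, j) \in upper_pairs.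
Proof. by move: i j => [|[|[|[|i]]]] [|[|[|[|[|j]]]]]; rewrite ?andbF. Qed.

Lemma entry_encode f i j : (i < j < 5)%N -> entry (encode f) i j = f i j.
Proof.
move=> ij; have [lt_ij _] := andP ij.
have ij_in := mem_upper_pairs ij.
by rewrite /entry (ltn_eqF lt_ij) lt_ij (nth_map (0, 0)%N) ?index_mem // nth_index.
Qed.

Lemma entry_diag c i : entry c i i.
Proof. by rewrite /entry eqxx. Qed.

Lemma entry_lower c i j : (j < i)%N -> entry c i j = false.
Proof. by move=> ji; rewrite /entry gtn_eqF // ltnNge ltnW. Qed.

Lemma F2_natr_eq0 (b : bool) : (b%:R == 0 :> 'F_2) = ~~ b.
Proof. by case: b. Qed.

Lemma F2_natr_neq0 (x : 'F_2) : (x != 0)%:R = x.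
Proof. by case: (F2_cases x) => ->. Qed.

Lemma F2_natr_addb (a b : bool) : (a (+) b)%:R = a%:R + b%:R :> 'F_2.
Proof. by case: a; case: b => //; apply/val_inj. Qed.

Lemma F2_natr_andb (a b : bool) : (a && b)%:R = a%:R * b%:R :> 'F_2.
Proof. by case: a; case: b; rewrite ?mul0r ?mulr0 ?mulr1. Qed.

Lemma F2_natr_inj (a b : bool) : (a%:R == b%:R :> 'F_2) = (a == b).
Proof. by case: a; case: b. Qed.

Lemma mx_of_encode (f : nat -> nat -> bool) (A : 'M['F_2]_5) :
  (forall i, A i i = 1) -> upper_triangular A ->
  (forall i j : 'I_5, (i < j)%N -> A i j = (f i j)%:R) -> mx_of_code (encode f) = A.
Proof.
move=> A1 A0 Af; apply/matrixP => i j; rewrite mxE; case: (ltngtP i j) => [ij|ji|ij].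
- by rewrite entry_encode ?ij ?ltn_ord // Af.
- by rewrite entry_lower // A0.
- by have -> : i = j by [apply/val_inj]; rewrite entry_diag A1.
Qed.

Lemma is_bottP n (A : 'M['F_2]_n) :
  reflect ((forall i, A i i = 1) /\ upper_triangular A) (is_bott A).
Proof.
apply: (iffP andP) => [[/forallP d /forallP l]|[d l]].
  by split=> [i|i j ji]; [apply/eqP|have /forallP/(_ j)/implyP/(_ ji)/eqP := l i].
split; apply/forallP => i; first by rewrite d.
by apply/forallP => j; apply/implyP => /l ->.
Qed.

Lemma mx_of_code_bott c : is_bott (mx_of_code c).
Proof.
apply/is_bottP; split=> [i|i j ji]; rewrite mxE ?entry_diag //.
by rewrite entry_lower.
Qed.

Lemma bott_code (A : 'M['F_2]_5) : is_bott A ->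
  exists2 c, c \in bits 10 & mx_of_code c = A.
Proof.
move=> /is_bottP[A1 A0]; exists (encode (fun i j => A (inord i) (inord j) != 0)).
  by rewrite mem_bits size_map.
by apply: mx_of_encode => // i j _; rewrite !inord_val F2_natr_neq0.
Qed.

Definition code_rank (c : bitseq) : nat :=
  count (fun j => all (fun i => entry c i j == (i == j)) (iota 0 5)) (iota 0 5).

Lemma max_torus_rank_code c : max_torus_rank (mx_of_code c) = code_rank c.
Proof.
rewrite /max_torus_rank cardE /code_rank -val_enum_ord count_map -size_filter.
rewrite val_enum_ord enumT [in LHS]/enum_mem; congr size; apply: eq_filter => j.
rewrite inE; apply: etrans (esym (all_iota 5 (fun i => entry c i j == (i == j)))).

by apply: eq_forallb => i; rewrite mxE F2_natr_eq0 negbK.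
Qed.

(** * The moves on codes and their closures *)

Section CodeMoves.
Variable R : realType.

Definition swap_nat (k i : nat) : nat :=
  if i == k then k.+1 else if i == k.+1 then k else i.

(** Exchanging k and k+1 keeps the matrix upper triangular only if the entry between them is zero.
    Otherwise the code is returned unchanged, so that the move is sound on every code. *)
Definition swap_code (k : nat) (c : bitseq) : bitseq :=
  if entry c k k.+1 then c else encode (fun i j => entry c (swap_nat k i) (swap_nat k j)).

Lemma swap_code_equiv k c : (k < 4)%N ->
  affine_equiv R (mx_of_code c) (mx_of_code (swap_code k c)).
Proof.
move=> k4; rewrite /swap_code; case: ifPn => ck; first exact: affine_equiv_refl.
have kb : (k < 5)%N by rewrite ltnS ltnW.
have k1b : (k.+1 < 5)%N by [].
pose s := tperm (Ordinal kb) (Ordinal k1b).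
have sE i : s i = swap_nat k i :> nat.
  rewrite /s /swap_nat; case: tpermP => [->|->|/eqP ik /eqP ik1] /=.
  - by rewrite eqxx.
  - by rewrite eqxx gtn_eqF.
  - by rewrite -val_eqE /= in ik; rewrite -val_eqE /= in ik1; rewrite (negbTE ik) (negbTE ik1).
have upA : upper_triangular (mx_of_code c) by have /is_bottP[] := mx_of_code_bott c.
have upB : upper_triangular (relabel_mx s (mx_of_code c)).
  move=> i j ji; rewrite !mxE !sE.
  have [e|/eqP e] := altP (swap_nat k i =P swap_nat k j).
    move: ji; rewrite (_ : i = j) ?ltnn //.
    by apply: (@perm_inj _ s); apply: ord_inj; rewrite !sE.
  case: (ltngtP (swap_nat k i) (swap_nat k j)) => [lt|lt|/e //]; last by rewrite entry_lower.
  (* An adjacent transposition reverses the order of one pair only. *)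
  have [-> ->] : swap_nat k i = k /\ swap_nat k j = k.+1.
    by move: lt ji; rewrite /swap_nat; do ![case: ifP => /eqP ?]; lia.
  by rewrite (negbTE ck).
rewrite (@mx_of_encode _ (relabel_mx s (mx_of_code c))) //.
- exact: relabel_equiv.
- by move=> i; rewrite !mxE entry_diag.
- by move=> i j _; rewrite !mxE !sE.
Qed.

Definition shift_code (k : nat) (c : bitseq) : bitseq :=
  encode (fun i j => entry c i j (+) [&& (i < k)%N, (k < j)%N, entry c i k & entry c k j]).

Lemma shift_code_equiv k c : (k < 5)%N ->
  affine_equiv R (mx_of_code c) (mx_of_code (shift_code k c)).
Proof.
move=> k5; have /is_bottP[A1 A0] := mx_of_code_bott c.
rewrite (@mx_of_encode _ (shift_mx (Ordinal k5) (mx_of_code c))).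
- exact: shift_equiv.
- move=> i; rewrite mxE A1 ifF ?addr0 //=.
  by case: ltngtP.
- move=> i j ji; rewrite mxE A0 // ifF ?addr0 //=.
  by apply/negbTE/negP => /andP[ik /(ltn_trans ik)]; rewrite ltnNge ltnW.
- move=> i j _; rewrite !mxE /= F2_natr_addb; congr (_ + _).
  by case: (ltnP i k) => //=; case: (ltnP k j) => //=; rewrite F2_natr_andb.
Qed.

Definition shear_code (m l : nat) (c : bitseq) : bitseq :=
  if (m < l)%N &&
     all (fun i => (i < l)%N ==> (entry c i l == (i < m)%N && entry c i m)) (iota 0 5)
  then encode (fun i j => entry c i j (+) [&& i == m, (l < j)%N & entry c l j])
  else c.

Lemma shear_code_equiv m l c : (m < 5)%N -> (l < 5)%N ->
  affine_equiv R (mx_of_code c) (mx_of_code (shear_code m l c)).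
Proof.
move=> m5 l5; rewrite /shear_code; case: ifP => [/andP[ml]|_]; last exact: affine_equiv_refl.
rewrite all_iota => /forallP col; have /is_bottP[A1 A0] := mx_of_code_bott c.
rewrite (@mx_of_encode _ (shear_mx (Ordinal m5) (Ordinal l5) (mx_of_code c))).
- apply: shear_equiv; split=> // i il; rewrite !mxE.
  by have /implyP/(_ il)/eqP -> := col i; case: ifP.
- move=> i; rewrite mxE A1 ifF ?addr0 //=; apply/negbTE/negP => /andP[/eqP -> /=].
  by rewrite ltnNge ltnW.
- move=> i j ji; rewrite mxE A0 // ifF ?addr0 //=; apply/negbTE/negP => /andP[/eqP im lj].
  by move: ji lj; rewrite im /= => jm lj; have := ltn_trans (ltn_trans jm ml) lj; rewrite ltnn.
- move=> i j _; rewrite !mxE /= F2_natr_addb -val_eqE /=; congr (_ + _).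
  by case: (i == m :> nat) => //=; case: (ltnP l j).
Qed.

Definition code_moves (c : bitseq) : seq bitseq :=
  [seq swap_code k c | k <- iota 0 4] ++ [seq shift_code k c | k <- iota 0 5] ++
  [seq shear_code m l c | m <- iota 0 5, l <- iota 0 5].

Lemma code_moves_equiv c c' : c' \in code_moves c ->
  affine_equiv R (mx_of_code c) (mx_of_code c').
Proof.
rewrite mem_cat => /orP[/mapP[k k4 ->]|].
  by apply: swap_code_equiv; rewrite mem_iota in k4.
rewrite mem_cat => /orP[/mapP[k k5 ->]|/allpairsP[p [m5 l5 ->]]].
  by apply: shift_code_equiv; rewrite mem_iota in k5.
by apply: shear_code_equiv; [rewrite mem_iota in m5 | rewrite mem_iota in l5].
Qed.

Fixpoint code_closure (fuel : nat) (seen frontier : seq bitseq) : seq bitseq :=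
  if fuel is fuel'.+1 then
    let new := undup [seq c <- flatten [seq code_moves c | c <- frontier] | c \notin seen] in
    code_closure fuel' (seen ++ new) new
  else seen.

Lemma code_closure_equiv fuel seen frontier c :
  {in seen, forall c', affine_equiv R (mx_of_code c) (mx_of_code c')} ->
  {in frontier, forall c', affine_equiv R (mx_of_code c) (mx_of_code c')} ->
  {in code_closure fuel seen frontier, forall c',
     affine_equiv R (mx_of_code c) (mx_of_code c')}.
Proof.
elim: fuel seen frontier => //= fuel IH seen frontier seenP frontierP.
set new := undup _.
have newP : {in new, forall c', affine_equiv R (mx_of_code c) (mx_of_code c')}.
  move=> c'; rewrite mem_undup mem_filter => /andP[_ /flatten_mapP[c'' /frontierP cc'' ]].
  by move=> /code_moves_equiv; exact: affine_equiv_trans.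
by apply: IH => // c'; rewrite mem_cat => /orP[/seenP|/newP].
Qed.

End CodeMoves.

(** * Evaluation of the invariant on codes *)

Definition code_cup_zero (c s t : bitseq) : bool :=
  all (fun p : nat * nat => let (i, j) := p in
    (nth false s i && nth false t j) (+) (nth false s j && nth false t i) ==
    [&& nth false s j, nth false t j & entry c i j]) upper_pairs.

Definition addb_seq (s t : bitseq) : bitseq := [seq p.1 (+) p.2 | p <- zip s t].

(** All 32 weights of a round are tabulated in the order of [bits 5]; unfolding the recursion of
    [cup_weight] would recompute them at every use. *)
Definition weight_table (c : bitseq) (k : nat) : seq nat :=
  let pts := bits 5 in
  iter k (fun W =>
      [seq (sumn [seq (nth 0 W (index t pts) + code_cup_zero c s t) *
                      nth 0 W (index (addb_seq s t) pts) | t <- pts] %% 7)%N | s <- pts])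
    (nseq (size pts) 1%N).

Definition code_invariant (c : bitseq) : nat :=
  sumn [seq (w * (w + 3))%N | w <- weight_table c 3].

(** Each code starts with the entry (0, 1) equal to 0: the first two columns are unit columns, and
    the matrix is already in block form. *)
Definition class_reps : seq bitseq :=
  [seq [seq d == 1 | d <- c] | c <-
  [:: [:: 0;0;0;0;1;0;0;1;0;1]; [:: 0;0;0;0;1;0;0;1;1;0]; [:: 0;0;0;0;1;0;1;1;0;0];
      [:: 0;0;0;0;1;0;1;1;0;1]; [:: 0;0;0;0;1;0;1;1;1;0]; [:: 0;0;0;0;1;1;1;0;0;0];
      [:: 0;0;0;1;1;0;0;1;0;0]; [:: 0;0;0;1;1;0;0;1;0;1]; [:: 0;0;0;1;1;0;0;1;1;0];
      [:: 0;0;0;1;1;1;0;0;0;0]; [:: 0;0;0;1;1;1;0;0;0;1]; [:: 0;0;1;0;1;0;0;0;1;1];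
      [:: 0;0;1;0;1;0;0;1;0;1]; [:: 0;0;1;0;1;0;0;1;1;1]; [:: 0;0;1;0;1;0;1;0;0;1];
      [:: 0;0;1;0;1;0;1;1;0;1]; [:: 0;0;1;1;1;0;0;1;1;0]; [:: 0;0;1;1;1;0;1;0;0;0];
      [:: 0;0;1;1;1;0;1;1;1;0]]%N]%N.


Definition row_of_bits (s : bitseq) : 'rV['F_2]_5 := \row_i (nth false s i)%:R.

Lemma row_of_bits_inj : {in bits 5 &, injective row_of_bits}.
Proof.
move=> s t; rewrite !mem_bits => /eqP s5 /eqP t5 /rowP st.
apply: (eq_from_nth (x0 := false)) => [|i]; rewrite s5 ?t5 // => i5.
by have /eqP := st (Ordinal i5); rewrite !mxE F2_natr_inj => /eqP.
Qed.

Lemma sum_rowE (F : 'rV['F_2]_5 -> nat) :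
  (\sum_a F a = sumn [seq F (row_of_bits s) | s <- bits 5])%N.
Proof.
rewrite sumnE big_map -[RHS](big_map row_of_bits predT F); apply: perm_big.
apply: uniq_perm; rewrite ?index_enum_uniq ?map_inj_in_uniq ?uniq_bits //.
  exact: row_of_bits_inj.
move=> a; rewrite mem_index_enum; apply/esym/mapP.
exists (mkseq (fun i => a 0 (inord i) != 0) 5); first by rewrite mem_bits size_mkseq.
apply/rowP => i; rewrite mxE nth_mkseq ?ltn_ord // inord_val.
by rewrite F2_natr_neq0.
Qed.

Lemma row_of_bitsD s t : s \in bits 5 -> t \in bits 5 ->
  row_of_bits (addb_seq s t) = row_of_bits s + row_of_bits t.
Proof.
rewrite !mem_bits => /eqP s5 /eqP t5; apply/rowP => i.
rewrite !mxE -F2_natr_addb (nth_map (false, false)) ?size_zip ?s5 ?t5 ?minnn ?ltn_ord //.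
by rewrite nth_zip ?s5 ?t5.
Qed.

Lemma addb_seq_bits s t : s \in bits 5 -> t \in bits 5 -> addb_seq s t \in bits 5.
Proof.
by rewrite !mem_bits size_map size_zip => /eqP -> /eqP ->.
Qed.

Lemma cup_zeroF_code c s t :
  cup_zeroF (mx_of_code c) (row_of_bits s) (row_of_bits t) = code_cup_zero c s t.
Proof.
have pairE (i j : 'I_5) :
    (row_of_bits s 0 i * row_of_bits t 0 j + row_of_bits s 0 j * row_of_bits t 0 i
      == row_of_bits s 0 j * row_of_bits t 0 j * mx_of_code c i j) =
    ((nth false s i && nth false t j) (+) (nth false s j && nth false t i) ==
     [&& nth false s j, nth false t j & entry c i j]).
  by rewrite !mxE -!F2_natr_andb -F2_natr_addb F2_natr_inj andbA.
apply/forallP/allP => [st [i j] ij|st i].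
  have /andP[lt_ij j5] : (i < j < 5)%N.
    by move: ij; rewrite !inE; do 10?[case/orP]; move=> /eqP[-> ->].
  have i5 := ltn_trans lt_ij j5.
  have /forallP/(_ (Ordinal j5))/implyP/(_ lt_ij) := st (Ordinal i5).
  by rewrite pairE.
apply/forallP => j; apply/implyP => ij; rewrite pairE.
by have := st (i : nat, j : nat); apply; apply: mem_upper_pairs; rewrite ij ltn_ord.
Qed.

Lemma weight_tableE c k s : s \in bits 5 ->
  nth 0%N (weight_table c k) (index s (bits 5)) = cup_weight (mx_of_code c) k (row_of_bits s).
Proof.
elim: k s => [|k IH] s s5.
  have -> : weight_table c 0 = nseq (size (bits 5)) 1%N by [].
  by rewrite nth_nseq index_mem s5.
rewrite /weight_table iterS -/(weight_table c k) (nth_map [::]) ?index_mem // nth_index //.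
rewrite /cup_weight iterS -/(cup_weight _ k) /cup_step sum_rowE.
congr (sumn _ %% 7)%N; apply/eq_in_map => t t5.
by rewrite !IH ?addb_seq_bits // row_of_bitsD // cup_zeroF_code.
Qed.

Lemma seq_nth_index (T : eqType) (S : Type) (x0 : S) (p : seq T) (w : seq S) :
  uniq p -> size w = size p -> w = [seq nth x0 w (index s p) | s <- p].
Proof.
move=> p_uniq wp; apply: (eq_from_nth (x0 := x0)); first by rewrite size_map.
move=> i; rewrite wp; case: p p_uniq wp => // a p p_uniq wp ip.
by rewrite (nth_map a) // index_uniq.
Qed.

Lemma cup_invariant_code c : cup_invariant (mx_of_code c) = code_invariant c.
Proof.
rewrite /cup_invariant sum_rowE /code_invariant; congr sumn.
have size_tbl k : size (weight_table c k) = size (bits 5).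
  by case: k => [|k]; rewrite /weight_table ?iterS ?size_nseq ?size_map.
rewrite (seq_nth_index 0%N (uniq_bits 5) (size_tbl 3)).
rewrite -map_comp; apply/eq_in_map => s s5.
by rewrite -weight_tableE.
Qed.

Lemma uniq_map_inj (T S : eqType) (f : T -> S) (p : seq T) :
  uniq (map f p) -> {in p &, injective f}.
Proof.
elim: p => //= a p IH /andP[fa p_uniq] x y; rewrite !inE.
move=> /orP[/eqP->|xp] /orP[/eqP->|yp] // fxy; last exact: IH fxy.
  by move: fa; rewrite fxy map_f.
by move: fa; rewrite -fxy map_f.
Qed.

Lemma uniq_rep_invariants : uniq [seq code_invariant c | c <- class_reps].
Proof. by vm_compute. Qed.

(** The upper bound on the number of classes; nine rounds of moves from the representatives suffice,
    as the evaluation confirms. *)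
Lemma closures_cover :
  let classes := flatten [seq code_closure 9 [:: r] [:: r] | r <- class_reps] in
  all (fun c => (code_rank c == 2%N) ==> (c \in classes)) (bits 10).
Proof. by vm_compute. Qed.

(** * The count of diffeomorphism classes *)

Section Classification.
Variable R : realType.
Implicit Types A B : 'M['F_2]_5.

Definition rank2_bott A : bool := is_bott A && (max_torus_rank A == 2%N).

Lemma rank2_bott_rep A : rank2_bott A ->
  exists2 r, r \in class_reps & affine_equiv R (mx_of_code r) A.
Proof.
move=> /andP[/bott_code[c c10 <-]]; rewrite max_torus_rank_code => c2.
have /allP/(_ c c10)/implyP/(_ c2)/flatten_mapP[r r_rep rc] := closures_cover.
exists r => //; apply: code_closure_equiv rc => c'; rewrite inE => /eqP ->;
  exact: affine_equiv_refl.
Qed.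

(** Both computations meet here: each matrix is joined by moves to a representative, and
    representatives with equal invariants coincide. *)
Lemma diffeomorphicE A B : rank2_bott A -> rank2_bott B ->
  `[< bott_diffeomorphic R A B >] = (cup_invariant A == cup_invariant B).
Proof.
move=> /rank2_bott_rep[r r_rep rA] /rank2_bott_rep[s s_rep sB].
apply/asboolP/eqP => [|AB]; first exact: diffeomorphic_cup_invariant.
have rs : code_invariant r = code_invariant s.
  rewrite -!cup_invariant_code.
  by rewrite (diffeomorphic_cup_invariant (affine_equiv_diffeomorphic rA)) AB
    (diffeomorphic_cup_invariant (affine_equiv_diffeomorphic sB)).
apply: affine_equiv_diffeomorphic; apply: affine_equiv_trans sB.
suff <- : r = s by exact: affine_equiv_sym.
exact: (uniq_map_inj uniq_rep_invariants).
Qed.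

(** The classes are the fibres of [cup_invariant] on [D], one for each representative. Leaving [D]
    general covers both sets counted in the theorem. *)
Lemma card_diffeo_classes (D : {set 'M['F_2]_5}) :
  {in D, forall A, rank2_bott A} -> {in class_reps, forall r, mx_of_code r \in D} ->
  #|bott_diffeo_classes R D| = 19%N.
Proof.
move=> D2 repsD.
pose cl v : {set 'M['F_2]_5} := [set A in D | v == cup_invariant A].
have -> : bott_diffeo_classes R D = [set X in [seq cl (code_invariant r) | r <- class_reps]].
  apply/setP => X; rewrite inE; apply/imsetP/mapP => [[A AD ->]|[r r_rep ->]].
    have [r r_rep rA] := rank2_bott_rep (D2 A AD); exists r => //.
    apply/setP => B; rewrite !inE; case BD : (B \in D) => //=.
    rewrite diffeomorphicE ?D2 // -cup_invariant_code.
    by rewrite (diffeomorphic_cup_invariant (affine_equiv_diffeomorphic rA)).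
  exists (mx_of_code r); first exact: repsD.
  apply/setP => B; rewrite !inE; case BD : (B \in D) => //=.
  by rewrite diffeomorphicE ?D2 ?repsD // cup_invariant_code.
rewrite cardsE (card_uniqP _) ?size_map //.
rewrite map_comp map_inj_in_uniq ?uniq_rep_invariants // => v w /mapP[r r_rep ->] _.
move=> /setP/(_ (mx_of_code r)); rewrite !inE repsD //= cup_invariant_code eqxx.
by move=> /esym/eqP.
Qed.

End Classification.

(** * The torus bundle form *)

Section TorusBundleForm.
Variables (k m : nat).
Implicit Type A : 'M['F_2]_(k + m).

Lemma torus_bundle_form_bott s A : torus_bundle_form s A -> is_bott A.
Proof.
move=> /existsP[C /existsP[B /and4P[/eqP -> /is_bottP[B1 B0] _ _]]]; apply/is_bottP; split.
  by move=> i; case: (split_ordP i) => j ->; rewrite ?block_mxEul ?block_mxEdr ?mxE ?eqxx.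
move=> i j; case: (split_ordP i) => i' ->; case: (split_ordP j) => j' -> /= ji.
- by rewrite block_mxEul mxE -val_eqE gtn_eqF.
- by move: ji; rewrite ltnNge ltnW // ltn_addr.
- by rewrite block_mxEdl mxE.
- by rewrite block_mxEdr B0 // -(ltn_add2l k).
Qed.

Lemma torus_bundle_form_rank s A : torus_bundle_form s A -> max_torus_rank A = k.
Proof.
move=> /existsP[C /existsP[B /and4P[/eqP -> /is_bottP[B1 B0] /forallP col _]]].
rewrite /max_torus_rank -sum1_card big_mkcond big_split_ord /= [X in (_ + X)%N]big1 ?addn0.
  rewrite (eq_bigr (fun=> 1%N)) ?sum1_card ?card_ord // => j _; rewrite inE ifT //.
  apply/forallP => i; case: (split_ordP i) => i' ->.
    by rewrite block_mxEul mxE eq_lshift; case: (i' == j).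
  by rewrite block_mxEdl mxE eqxx eq_rlshift.
move=> j _; rewrite inE ifF //; apply/negbTE/negP => /forallP diag.
have := col j; rewrite leqNgt => /negP; apply.
rewrite ltnS (eq_card (B := pred1 (rshift k j))) ?card1 // => i.
by rewrite !inE (eqP (diag i)).
Qed.

Lemma torus_bundle_formI A : is_bott A ->
  (forall i j : 'I_k, i != j -> A (lshift m i) (lshift m j) = 0) ->
  (forall j : 'I_m, exists2 i, i != rshift k j & A i (rshift k j) != 0) ->
  torus_bundle_form (\rank (ursubmx A)) A.
Proof.
move=> /is_bottP[A1 A0] Aul col.
apply/existsP; exists (ursubmx A); apply/existsP; exists (drsubmx A); apply/and4P; split=> //.
- rewrite -{1}(submxK A); apply/eqP; congr block_mx; apply/matrixP => i j; rewrite !mxE.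
    by have [->|ij] := eqVneq i j; [rewrite A1 | rewrite Aul].
  by rewrite A0 //= ltn_addr.
- apply/is_bottP; split=> [i|i j ji]; rewrite !mxE ?A1 //.
  by rewrite A0 //= ltn_add2l.
- apply/forallP => j; have [i ij Aij] := col j.
  rewrite (cardD1 (rshift k j)) inE A1 oner_neq0 (cardD1 i).
  by rewrite !inE ij Aij.
Qed.

End TorusBundleForm.

Lemma torus_bundle_form_reps :
  all (fun c => ~~ entry c 0 1 &&
        all (fun j => has (fun i => (i != j) && entry c i j) (iota 0 5)) [:: 2; 3; 4]%N)
      class_reps.
Proof. by vm_compute. Qed.

Lemma rep_torus_bundle_form r : r \in class_reps ->
  torus_bundle_form (k := 2) (m := 3) 1 (mx_of_code r) ||
  torus_bundle_form (k := 2) (m := 3) 2 (mx_of_code r).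
Proof.
move=> /(allP torus_bundle_form_reps)/andP[r01 /allP r_col].
pose A : 'M['F_2]_(2 + 3) := mx_of_code r.
have Abott : is_bott A := mx_of_code_bott r.
have col (j : 'I_3) : exists2 i, i != rshift 2 j & A i (rshift 2 j) != 0.
  have hj : has (fun i : nat => (i != rshift 2 j :> nat) && entry r i (rshift 2 j)) (iota 0 5).
    by apply: r_col; rewrite !inE /=; case: j => [[|[|[|]]]].
  have /hasP[i i5 /andP[ij rij]] := hj; rewrite mem_iota in i5.
  exists (Ordinal i5 : 'I_(2 + 3)) => //.
  by rewrite mxE F2_natr_eq0 negbK.
have form : torus_bundle_form (\rank (ursubmx A)) A.
  apply: torus_bundle_formI => // i j ij; rewrite mxE; apply/eqP; rewrite F2_natr_eq0.
  case: i ij => -[|[|//]] i2; case: j => -[|[|//]] j2 //= _.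
have rank_gt0 : (0 < \rank (ursubmx A))%N.
  rewrite lt0n mxrank_eq0; apply/eqP => C0.
  (* The first column of B has only its diagonal entry, so the second nonzero entry of this column
     of A must lie in C. *)
  have [i + +] := col ord0; case: (split_ordP i) => i' -> i'0.
    by move: C0 => /matrixP/(_ i' ord0); rewrite !mxE => ->; rewrite eqxx.
  move: i'0; rewrite (inj_eq (@rshift_inj _ _)) => i'0.
  have /is_bottP[_ ->] := Abott; rewrite ?eqxx //=.
  by rewrite ltn_add2l lt0n.
move: form rank_gt0 (rank_leq_row (ursubmx A)).
by case: (\rank _) => [|[|[|]]] // -> //; rewrite orbT.
Qed.

Local Close Scope ring_scope.
Local Close Scope classical_set_scope.

Theorem proposition3p7 (R : realType) :
  [/\ #|bott_diffeo_classes R [set A : 'M['F_2]_(2 + 3) |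
          torus_bundle_form 1 A || torus_bundle_form 2 A]%SET| = 19,
      #|bott_diffeo_classes R [set A : 'M['F_2]_(2 + 3) |
          is_bott A && (max_torus_rank A == 2)]%SET| = 19 &
      forall A : 'M['F_2]_(2 + 3), is_bott A -> max_torus_rank A = 2 ->
        exists A' : 'M['F_2]_(2 + 3),
          (torus_bundle_form 1 A' || torus_bundle_form 2 A') /\
          bott_diffeomorphic R A A'].
Proof.
have rank2 (A : 'M['F_2]_(2 + 3)) s : torus_bundle_form s A -> rank2_bott A.
  move=> form; rewrite /rank2_bott (torus_bundle_form_bott form).
  by rewrite (torus_bundle_form_rank form) eqxx.
split.
- apply: card_diffeo_classes => [A|r r_rep]; rewrite inE; last exact: rep_torus_bundle_form.
  by case/orP => /rank2.
- apply: card_diffeo_classes => [A|r r_rep]; rewrite inE //.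
  by have /orP[] := rep_torus_bundle_form r_rep => /rank2.
- move=> A A_bott A2.
  have [|r r_rep rA] := @rank2_bott_rep R A; first by rewrite /rank2_bott A_bott A2 eqxx.
  exists (mx_of_code r); split; first exact: rep_torus_bundle_form.
  exact/affine_equiv_diffeomorphic/affine_equiv_sym.
Qed.
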